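(* The isomorphism relation $\cong$ on the standard Borel space $\mathcal{BO}$ of finitely generated bi-orderable groups, i.e. the relation on $\mathcal{BO}$ given by $N \cong M$ if and only if the groups $\mathbb{F}_\infty/N$ and $\mathbb{F}_\infty/M$ are isomorphic, is a weakly universal countable Borel equivalence relation.
   Context: A bi-ordering of a group $G$ is a strict total ordering $<$ of $G$ that is invariant under left and right multiplication; $G$ is bi-orderable if it admits a bi-ordering (the trivial group is bi-orderable). $\mathbb{F}_\infty$ is the free group on the countably infinite set $\{x_i : i \in \mathbb{N}\}$. The power set $2^{\mathbb{F}_\infty}$ carries the product topology, with subbasis the sets $\{S : g \in S\}$ and $\{S : g \notin S\}$ for $g \in \mathbb{F}_\infty$. $\mathcal{N} \subset 2^{\mathbb{F}_\infty}$ is the set of all normal subgroups of $\mathbb{F}_\infty$ that contain all but finitely many of the $x_i$. $\mathcal{BO}$ is the set of all $N \in \mathcal{N}$ such that $\mathbb{F}_\infty/N$ is bi-orderable; it is a Borel subset of $2^{\mathbb{F}_\infty}$ and is regarded as a standard Borel space with the inherited Borel structure. An equivalence relation $E$ on a standard Borel space $X$ is Borel if $E$ is a Borel subset of $X \times X$, and a Borel equivalence relation is countable if every equivalence class is countable. For countable Borel equivalence relations $E$ on $X$ and $F$ on $Y$, $E$ is weakly Borel reducible to $F$ (written $E \leq^w_B F$) if there is a countable-to-one Borel map $f \colon X \to Y$ such that $x \mathbin{E} y \implies f(x) \mathbin{F} f(y)$ for all $x,y \in X$. A countable Borel equivalence relation $E$ is weakly universal if $F \leq^w_B E$ for every countable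 Borel equivalence relation $F$. *)

(* Defs.v *)
From HB Require Import structures.
From mathcomp Require Import all_boot all_order all_algebra.
From mathcomp Require Import all_classical all_reals all_analysis.
From Stdlib Require Import RelationClasses.

Set Implicit Arguments.
Unset Strict Implicit.
Unset Printing Implicit Defensive.

Local Open Scope classical_set_scope.
Local Open Scope group_scope.

(* The free group on an alphabet A, carried by the reduced words: the letter
   (a, true) stands for the generator a, and (a, false) for its inverse. *)
Section FreeGroup.
Variable A : choiceType.

Definition letter : Type := (A * bool)%type.

Definition letter_inv (l : letter) : letter := (l.1, ~~ l.2).

Definition reduced (w : seq letter) : bool :=
  sorted [rel l m | m != letter_inv l] w.

Definition act_letter (l : letter) (w : seq letter) : seq letter :=
  if w is m :: w' then if m == letter_inv l then w' else l :: w else [:: l].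

Definition act_word (u w : seq letter) : seq letter := foldr act_letter w u.

Definition inv_word (w : seq letter) : seq letter := rev (map letter_inv w).

Lemma letter_invK : involutive letter_inv.
Proof. by case=> a b; rewrite /letter_inv /= negbK. Qed.

Lemma letter_inv_neq l : l != letter_inv l.
Proof. by case: l => a []; rewrite /letter_inv /= xpair_eqE /= andbF. Qed.

Lemma reduced_tl l w : reduced (l :: w) -> reduced w.
Proof. exact: path_sorted. Qed.

Lemma act_letter_reduced l w : reduced w -> reduced (act_letter l w).
Proof.
case: w => [|m w] //= rw; case: ifPn => [_|mN]; first exact: reduced_tl rw.
by rewrite /reduced /= mN.
Qed.

Lemma act_word_reduced u w : reduced w -> reduced (act_word u w).
Proof. by move=> rw; elim: u => //= l u; exact: act_letter_reduced. Qed.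

Lemma act_letterK l w :
  reduced w -> act_letter l (act_letter (letter_inv l) w) = w.
Proof.
case: w => [|m w] /=; first by rewrite eqxx.
rewrite letter_invK; case: eqP => [-> |_ _] /=; last by rewrite eqxx.
case: w => [|k w] //= /andP[kN _].
by rewrite (negbTE kN).
Qed.

Lemma act_letterVK l w :
  reduced w -> act_letter (letter_inv l) (act_letter l w) = w.
Proof. by move=> rw; rewrite -{2}(letter_invK l) act_letterK. Qed.

Lemma act_word_nil w : reduced w -> act_word w [::] = w.
Proof.
elim: w => //= l w IHw rlw; rewrite (IHw (reduced_tl rlw)).
by case: w {IHw} rlw => //= m w /andP[/negbTE -> _].
Qed.

Lemma act_word_letter l u w :
  reduced w -> act_word (act_letter l u) w = act_letter l (act_word u w).
Proof.
move=> rw; case: u => [|m u] //=; case: eqP => [->|_] //=.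
by rewrite act_letterK // act_word_reduced.
Qed.

Lemma act_wordA u v w :
  reduced w -> act_word (act_word u v) w = act_word u (act_word v w).
Proof. by move=> rw; elim: u => //= l u <-; rewrite act_word_letter. Qed.

Lemma act_wordVK u w : reduced w -> act_word (inv_word u) (act_word u w) = w.
Proof.
rewrite /inv_word; elim: u w => //= l u IHu w rw.
rewrite rev_cons /act_word foldr_rcons act_letterVK; first exact: IHu.
exact: act_word_reduced.
Qed.

Lemma inv_wordK : involutive inv_word.
Proof.
move=> w; rewrite /inv_word map_rev revK -map_comp -[RHS]map_id.
by apply: eq_map => l /=; rewrite letter_invK.
Qed.

Lemma inv_word_reduced w : reduced w -> reduced (inv_word w).
Proof.
rewrite /reduced /inv_word rev_sorted sorted_map; apply: sub_sorted => l m /=.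
by rewrite letter_invK eq_sym.
Qed.

Record free_group : Type := FreeWord {
  word_of : seq letter;
  word_ofP : reduced word_of }.

HB.instance Definition _ := [isSub for word_of].
HB.instance Definition _ := [Choice of free_group by <:].

Definition fg_one : free_group := @FreeWord [::] isT.
Definition fg_inv (x : free_group) : free_group :=
  FreeWord (inv_word_reduced (word_ofP x)).
Definition fg_mul (x y : free_group) : free_group :=
  FreeWord (act_word_reduced (word_of x) (word_ofP y)).

Lemma fg_mulA : associative fg_mul.
Proof. by move=> x y z; apply: val_inj; rewrite /= act_wordA // word_ofP. Qed.

Lemma fg_mul1 : left_id fg_one fg_mul.
Proof. by move=> x; apply: val_inj. Qed.

Lemma fg_mulr1 : right_id fg_one fg_mul.
Proof. by move=> x; apply: val_inj; rewrite /= act_word_nil // word_ofP. Qed.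

Lemma fg_mulV : left_inverse fg_one fg_inv fg_mul.
Proof.
move=> x; apply: val_inj => /=.
by rewrite -{2}(act_word_nil (word_ofP x)) act_wordVK.
Qed.

Lemma fg_mulrV : right_inverse fg_one fg_inv fg_mul.
Proof.
have fg_invK : involutive fg_inv.
  by move=> x; apply: val_inj; rewrite /= inv_wordK.
by move=> x; rewrite -{1}(fg_invK x) fg_mulV.
Qed.

HB.instance Definition _ :=
  isGroup.Build free_group fg_mulA fg_mul1 fg_mulr1 fg_mulV fg_mulrV.

HB.instance Definition _ := isPointed.Build free_group 1.

Definition fg_gen (a : A) : free_group := @FreeWord [:: (a, true)] isT.

Section UniversalProperty.
Variables (G : groupType) (h : A -> G).

Definition letter_eval (l : letter) : G := if l.2 then h l.1 else (h l.1)^-1.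

Definition fg_lift (x : free_group) : G :=
  foldr (fun l z => letter_eval l * z) 1 (word_of x).

Lemma letter_evalV l : letter_eval (letter_inv l) = (letter_eval l)^-1.
Proof. by case: l => a []; rewrite /letter_eval /= ?invgK. Qed.

Lemma fg_lift_gen a : fg_lift (fg_gen a) = h a.
Proof. exact: mulg1. Qed.

Lemma fg_liftM : {morph fg_lift : x y / x * y}.
Proof.
move=> [u ru] [v rv]; rewrite /fg_lift /=; elim: u {ru} => [|l u IHu] /=.
  by rewrite mul1g.
rewrite -mulgA -IHu; case: (act_word u v) => [|m w] //=.
by case: eqP => [->|_] //=; rewrite letter_evalV mulVKg.
Qed.

Lemma fg_lift_unique (f : free_group -> G) :
  {morph f : x y / x * y} -> (forall a, f (fg_gen a) = h a) -> f =1 fg_lift.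
Proof.
move=> fM fh; have f1 : f 1 = 1 by apply: (mulgI (f 1)); rewrite -fM !mulg1.
have fV x : f x^-1 = (f x)^-1.
  by apply: (mulgI (f x)); rewrite -fM !mulgV.
case=> w rw; rewrite /fg_lift /=.
elim: w rw => [|l w IHw] rlw /=; first by rewrite -f1; congr f; apply: val_inj.
rewrite -(IHw (reduced_tl rlw)); set y := FreeWord _.
have -> : letter_eval l = f (@FreeWord [:: l] isT).
  case: (l) => a []; rewrite /letter_eval /= -fh -?fV; congr f;
  exact: val_inj.
rewrite -fM; congr f; apply: val_inj => /=.
by clear y; case: w rlw {IHw} => //= m w /andP[/negbTE -> _].
Qed.

End UniversalProperty.

End FreeGroup.

Section Groups.

Definition bi_ordering (G : groupType) (lt : G -> G -> Prop) : Prop :=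
  [/\ StrictOrder lt,
      forall x y : G, x <> y -> lt x y \/ lt y x,
      forall z x y : G, lt x y -> lt (z * x) (z * y)
    & forall z x y : G, lt x y -> lt (x * z) (y * z)].

Definition bi_orderable (G : groupType) : Prop :=
  exists lt : G -> G -> Prop, bi_ordering lt.

Definition isomorphic (G H : groupType) : Prop :=
  exists2 f : G -> H, bijective f & {morph f : x y / x * y}.

Definition is_normal_subgroup (G : groupType) (N : set G) : Prop :=
  [/\ N 1,
      forall x y, N x -> N y -> N (x * y),
      forall x, N x -> N x^-1
    & forall x y, N x -> N (x ^ y)].

Record normal_subgroup (G : groupType) := NormalSubgroup {
  ns_set : set G;
  ns_normal : is_normal_subgroup ns_set }.

End Groups.

Section Quotient.
Variables (G : groupType) (N : normal_subgroup G).

Definition coset_eq (x y : G) : bool := `[< ns_set N (x^-1 * y) >].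

Lemma coset_eq_refl : reflexive coset_eq.
Proof. by move=> x; apply/asboolP; rewrite mulVg; case: (ns_normal N). Qed.

Lemma coset_eq_sym : symmetric coset_eq.
Proof.
have sym x y : coset_eq x y -> coset_eq y x.
  move=> /asboolP Nxy; apply/asboolP; have [_ _ NV _] := ns_normal N.
  by have := NV _ Nxy; rewrite invgM invgK.
by move=> x y; apply/idP/idP; exact: sym.
Qed.

Lemma coset_eq_trans : transitive coset_eq.
Proof.
move=> y x z /asboolP Nxy /asboolP Nyz; apply/asboolP.
have [_ NM _ _] := ns_normal N; have := NM _ _ Nxy Nyz.
by rewrite mulgA mulgK.
Qed.

Definition coset_equiv : equiv_rel G :=
  EquivRel coset_eq coset_eq_refl coset_eq_sym coset_eq_trans.

Local Open Scope quotient_scope.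

Definition quotient_group : Type := {eq_quot coset_equiv}.
HB.instance Definition _ := Choice.on quotient_group.
HB.instance Definition _ := EqQuotient.on quotient_group.

Definition coset_pi (x : G) : quotient_group := \pi_quotient_group x.

Lemma coset_piP (x y : G) : coset_pi x = coset_pi y <-> ns_set N (x^-1 * y).
Proof.
split=> [/eqP|Nxy]; first by rewrite /coset_pi eqmodE => /asboolP.
by apply/eqP; rewrite /coset_pi eqmodE; apply/asboolP.
Qed.

Lemma coset_reprK : cancel repr coset_pi.
Proof. exact: reprK. Qed.

Definition qone : quotient_group := coset_pi 1.
Definition qinv (a : quotient_group) : quotient_group := coset_pi (repr a)^-1.
Definition qmul (a b : quotient_group) : quotient_group :=
  coset_pi (repr a * repr b).

Lemma qmulE (x y : G) : qmul (coset_pi x) (coset_pi y) = coset_pi (x * y).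
Proof.
apply/coset_piP; set a := repr (coset_pi x); set b := repr (coset_pi y).
have Na : ns_set N (a^-1 * x) by apply/coset_piP; exact: coset_reprK.
have Nb : ns_set N (b^-1 * y) by apply/coset_piP; exact: coset_reprK.
have [_ NM _ NJ] := ns_normal N.
have := NM _ _ (NJ _ b Na) Nb.
by rewrite /conjg invgM !mulgA mulgK.
Qed.

Lemma qinvE (x : G) : qinv (coset_pi x) = coset_pi x^-1.
Proof.
apply/coset_piP; set a := repr (coset_pi x).
have Na : ns_set N (a^-1 * x) by apply/coset_piP; exact: coset_reprK.
have [_ _ NV NJ] := ns_normal N.
have := NV _ (NJ _ a^-1 Na).
by rewrite /conjg !invgK !mulgA mulgV mul1g invgM invgK.
Qed.

Lemma qmulA : associative qmul.
Proof.
move=> a b c; rewrite -(coset_reprK a) -(coset_reprK b) -(coset_reprK c).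
by rewrite !qmulE mulgA.
Qed.

Lemma qmul1 : left_id qone qmul.
Proof. by move=> a; rewrite -(coset_reprK a) qmulE mul1g. Qed.

Lemma qmulr1 : right_id qone qmul.
Proof. by move=> a; rewrite -(coset_reprK a) qmulE mulg1. Qed.

Lemma qmulV : left_inverse qone qinv qmul.
Proof. by move=> a; rewrite -(coset_reprK a) qinvE qmulE mulVg. Qed.

Lemma qmulrV : right_inverse qone qinv qmul.
Proof. by move=> a; rewrite -(coset_reprK a) qinvE qmulE mulgV. Qed.

HB.instance Definition _ :=
  isGroup.Build quotient_group qmulA qmul1 qmulr1 qmulV qmulrV.

Lemma coset_piM : {morph coset_pi : x y / x * y}.
Proof. by move=> x y; rewrite [RHS]qmulE. Qed.

End Quotient.

Notation borel_space T := (g_sigma_algebraType (@open T)).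

Section BorelEquivalence.

(* A Hausdorff complete pseudometric space is completely metrizable. *)
Definition polish (R : realType) (P : completePseudoMetricType R) : Prop :=
  hausdorff_space P /\ exists2 D : set P, countable D & dense D.

(* As a measurableType is inhabited by definition, so are all the standard
   Borel spaces below. The empty one carries only the empty relation, which is
   weakly reducible to every relation. *)
Definition standard_borel (R : realType) d (X : measurableType d) : Prop :=
  exists2 P : completePseudoMetricType R, polish P &
    exists (f : X -> borel_space P) (g : borel_space P -> X),
      [/\ cancel f g, cancel g f, measurable_fun setT f & measurable_fun setT g].

Definition countable_borel_equivalence (R : realType) d (X : measurableType d)
    (E : X -> X -> Prop) : Prop :=
  [/\ standard_borel R X,
      Equivalence E,
      measurable [set p : X * X | E p.1 p.2]
    & forall x, countable [set y | E x y]].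

Definition weakly_reducible dX dY (X : measurableType dX)
    (Y : measurableType dY) (E : X -> X -> Prop) (F : Y -> Y -> Prop) : Prop :=
  exists f : X -> Y,
    [/\ measurable_fun setT f,
        forall y, countable (f @^-1` [set y])
      & forall x x', E x x' -> F (f x) (f x')].

Definition weakly_universal (R : realType) d (X : measurableType d)
    (E : X -> X -> Prop) : Prop :=
  countable_borel_equivalence R E /\
  forall dY (Y : measurableType dY) (F : Y -> Y -> Prop),
    countable_borel_equivalence R F -> weakly_reducible F E.

End BorelEquivalence.

Notation F_infty := (free_group nat).

(* The power set of F_infty: its product topology has as subbasis the sets
   {S | g \in S} and {S | g \notin S}, indexed by (g, true) and (g, false). *)
Definition pow_F : Type := set F_infty.

HB.instance Definition _ := Choice.on pow_F.
HB.instance Definition _ := isPointed.Build pow_F set0.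

Definition pow_F_subbase (i : F_infty * bool) : set pow_F :=
  [set S : pow_F | if i.2 then S i.1 else ~ S i.1].

HB.instance Definition _ :=
  @isSubBaseTopological.Build pow_F (F_infty * bool)%type setT pow_F_subbase.

Definition normal_cofinite : set pow_F :=
  [set N : pow_F | is_normal_subgroup N /\
                   finite_set [set i : nat | ~ N (fg_gen i)]].

Definition BO : set pow_F :=
  [set N : pow_F | normal_cofinite N /\
     exists nN : is_normal_subgroup (N : set F_infty),
       bi_orderable (quotient_group (NormalSubgroup nN))].

Lemma BO_setT : BO setT.
Proof.
have nT : is_normal_subgroup [set: F_infty] by [].
split; first by split=> //; rewrite (_ : [set _ | _] = set0) // -subset0 => i; exact.
exists nT; exists (fun _ _ => False); split=> // [|x y].
  by split=> [x []|x y z []].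
rewrite -(coset_reprK x) -(coset_reprK y) => xy; exfalso; apply: xy.
exact/coset_piP.
Qed.

Definition BO_elt : Type := BO.
HB.instance Definition _ := Choice.on BO_elt.
HB.instance Definition _ := isPointed.Build BO_elt (SigSub (mem_set BO_setT)).

Definition BO_val (N : BO_elt) : borel_space pow_F := val N.

(* Its measurable sets are the traces on BO of the Borel sets of pow_F. *)
Definition BO_space := g_sigma_algebra_preimageType BO_val.

Lemma BO_normal (N : BO_elt) : is_normal_subgroup (BO_val N : set F_infty).
Proof. by case: (set_valP N) => -[]. Qed.

Definition BO_group (N : BO_elt) : groupType :=
  quotient_group (NormalSubgroup (BO_normal N)).

Definition BO_iso (N M : BO_elt) : Prop := isomorphic (BO_group N) (BO_group M).

(* Main.v *)
Require Import Defs.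
From HB Require Import structures.
From mathcomp Require Import all_boot all_order all_algebra.
From mathcomp Require Import all_classical all_reals all_analysis.
From mathcomp Require Import lra ring.
From Stdlib Require Import RelationClasses.

(** The relation is countable Borel because an isomorphism from the quotient by
    [N] to the quotient by [M] lifts to an endomorphism of [F_infty] that kills
    all but finitely many generators, and there are only countably many of
    these ([BO_isoP]). The space is standard Borel because membership of group
    elements, together with the least [n] such that all generators from [n] on
    lie in [N], codes [BO] as a closed set of sequences of naturals: a limit of
    bi-orderable quotients is bi-ordered by an ultralimit of the orders
    ([BO_complete]).

    For universality, let [F] be a countable Borel equivalence relation on [Y].
    The Lusin-Novikov theorem ([lusin_novikov]), proved here by building a
    perfect set inside a section that countably many Borel functions fail to
    cover, gives Borel involutions [g k] of [Y] such that equivalent points are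
    exchanged by one of them ([feldman_moore]). The free group [Gamma] on [s]
    and [t] then acts on [Y * int]: [s] shifts the integer and [t] applies
    [g n] on level [n]. So equivalent points of level [0] lie in one orbit.

    The group theory takes place in the wreath product [W] of [Gamma] with
    itself, which is bi-orderable since [Gamma] is. Let [a] and [b] be
    non-commuting elements of the base group that live at the coordinate [1].
    The conjugate of [b] by [d] in the top copy of [Gamma] lives at the
    coordinate [d], so it commutes with [a] exactly when [d] is not [1]. Let
    [rho] send the first four generators of [F_infty] to [s], [t], [a], [b] and
    the others to [1], and let [theta d] be the automorphism of [F_infty] that
    conjugates the fourth generator by [d]. For a subset [D] of [Gamma] let
    [hall D] be the intersection over [d] in [D] of the kernels of
    [rho \o theta d]. Three facts make this family universal.
    - The quotient by [hall D] embeds in a power of [W], so it is bi-orderable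
      ([hall_bi_orderable]).
    - The commutator of the third and fourth generators detects the members of
      [D], so [hall D] determines [D] ([hall_mem]).
    - Left translation of [D] changes [hall D] by an automorphism of [F_infty]
      ([hall_translate]).
    Sending [y] to [hall (marks y)], where [marks y] records the digits of the
    points of the orbit of [(y, 0)], is therefore Borel and injective, and it
    maps equivalent points to isomorphic groups ([encoding]). *)

Set Implicit Arguments.
Unset Strict Implicit.
Unset Printing Implicit Defensive.

Import Order.TTheory GRing.Theory Num.Theory.

(** * Measurability of sets given by countable formulas *)

Section Toolkit.
Local Open Scope classical_set_scope.
Context d (T : measurableType d).

Lemma meas_ex (I : countType) (A : I -> T -> Prop) :
  (forall i, measurable [set x | A i x]) -> measurable [set x | exists i, A i x].
Proof.
move=> mA; rewrite (_ : [set x | _] =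
  \bigcup_n (if unpickle n is Some i then [set x | A i x] else set0)).
  by apply: bigcupT_measurable => n; case: unpickle.
apply/seteqP; split=> x /=.
  by case=> i Aix; exists (pickle i) => //; rewrite pickleK.
by case=> n _; case: unpickle => // i; exists i.
Qed.

Lemma meas_not (A : T -> Prop) :
  measurable [set x | A x] -> measurable [set x | ~ A x].
Proof. exact: measurableC. Qed.

Lemma meas_all (I : countType) (A : I -> T -> Prop) :
  (forall i, measurable [set x | A i x]) -> measurable [set x | forall i, A i x].
Proof.
move=> mA; rewrite (_ : [set x | _] = ~` [set x | exists i, ~ A i x]).
  by apply: measurableC; apply: meas_ex => i; exact: meas_not.
apply/seteqP; split=> x /=; first by move=> Ax [i]; apply; exact: Ax.
by move=> nA i; apply: contrapT => nAi; apply: nA; exists i.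
Qed.

Lemma meas_and (A B : T -> Prop) : measurable [set x | A x] ->
  measurable [set x | B x] -> measurable [set x | A x /\ B x].
Proof. exact: measurableI. Qed.

Lemma meas_or (A B : T -> Prop) : measurable [set x | A x] ->
  measurable [set x | B x] -> measurable [set x | A x \/ B x].
Proof. exact: measurableU. Qed.

Lemma meas_imp (A B : T -> Prop) : measurable [set x | A x] ->
  measurable [set x | B x] -> measurable [set x | A x -> B x].
Proof.
move=> mA mB; rewrite (_ : [set x | _] = [set x | ~ A x \/ B x]).
  by apply: meas_or => //; exact: meas_not.
apply/seteqP; split=> x /=; last by case.
by move=> AB; have [/AB|] := pselect (A x); [right|left].
Qed.

Lemma meas_prop (P : Prop) : measurable [set x : T | P].
Proof.
have [p|np] := pselect P.
  by rewrite (_ : [set x | _] = setT) //; apply/seteqP; split.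
by rewrite (_ : [set x | _] = set0) //; apply/seteqP; split.
Qed.

Lemma meas_iff (A B : T -> Prop) : measurable [set x | A x] ->
  measurable [set x | B x] -> measurable [set x | A x <-> B x].
Proof. by move=> mA mB; apply: meas_and; exact: meas_imp. Qed.

Lemma meas_pre d' (T' : measurableType d') (f : T' -> T) (A : T -> Prop) :
  measurable_fun setT f -> measurable [set x | A x] ->
  measurable [set x | A (f x)].
Proof. by move=> mf mA; rewrite -[X in measurable X]setTI; exact: mf. Qed.

End Toolkit.

Lemma countable_enum (T : Type) (x0 : T) (A : set T) : countable A ->
  exists z : nat -> T, forall y, A y -> exists n, y = z n.
Proof.
move=> /countable_injP[e einj].
have /choice[z zP] n : exists y, (exists2 y', A y' & e y' = n) -> A y /\ e y = n.
  by have [[y Ay ey]|ne] := pselect (exists2 y', A y' & e y' = n); [exists y|exists x0].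
exists z => y Ay; exists (e y).
have [Az ez] := zP (e y) (ex_intro2 _ _ y Ay erefl).
by apply: einj; rewrite ?inE.
Qed.

(** * The Baire space *)

Section Baire.
Local Open Scope classical_set_scope.

Definition cylinders : set (set (nat -> nat)) :=
  [set A | exists i m, A = [set x | x i = m]].

(** The sequences of naturals with the sigma-algebra generated by the cylinders,
    which is the Borel one for the product topology. *)
Definition baire : Type := g_sigma_algebraType cylinders.
HB.instance Definition _ := Measurable.on baire.

Lemma meas_coord d (T : measurableType d) (h : T -> baire) i (Q : nat -> Prop) :
  measurable_fun setT h -> measurable [set x | Q (h x i)].
Proof.
move=> mh; rewrite (_ : [set x | _] = [set x | exists m, Q m /\ h x i = m]).
  apply: meas_ex => m; apply: meas_and; first exact: meas_prop.
  apply: (meas_pre (A := fun z : baire => z i = m)) mh _.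
  by apply: sub_sigma_algebra; exists i, m.
by apply/seteqP; split=> x /=; [exists (h x i)|case=> m [] + ->].
Qed.

Lemma meas_baire d (T : measurableType d) (h : T -> baire) :
  (forall i m, measurable [set x | h x i = m]) -> measurable_fun setT h.
Proof.
move=> mh; apply: (@measurability _ _ _ _ setT h cylinders) => //.
by move=> _ [_ [i [m ->]] <-]; rewrite setTI; exact: mh.
Qed.

(** A finite initial segment takes countably many values, so every property of it
    is Borel. *)
Lemma meas_coords d (T : measurableType d) (h : T -> baire) n
    (Q : seq nat -> Prop) :
  measurable_fun setT h -> measurable [set x | Q (mkseq (h x) n)].
Proof.
move=> mh; rewrite (_ : [set x | _] =
  [set x | exists s : seq nat, (Q s /\ size s = n) /\
           forall i, (i < n)%N -> h x i = nth 0%N s i]).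
  apply: meas_ex => s; apply: meas_and; first exact: meas_prop.
  apply: meas_all => i; apply: meas_imp; first exact: meas_prop.
  exact: (meas_coord (h := h) i (fun k => k = nth 0%N s i)).
apply/seteqP; split=> x /=.
  move=> Qx; exists (mkseq (h x) n); split; first by rewrite size_mkseq.
  by move=> i im; rewrite nth_mkseq.
case=> s [[Qs ss] hs]; rewrite (_ : mkseq _ _ = s) //.
apply: (@eq_from_nth _ 0%N); rewrite size_mkseq // => i im.
by rewrite nth_mkseq // hs.
Qed.

Lemma meas_eq_fun d (T : measurableType d) (h k : T -> baire) :
  measurable_fun setT h -> measurable_fun setT k ->
  measurable [set x | h x = k x].
Proof.
move=> mh mk; rewrite (_ : [set x | _] =
   [set x | forall i, exists m, h x i = m /\ k x i = m]).
  apply: meas_all => i; apply: meas_ex => m.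
  by apply: meas_and; exact: (@meas_coord _ _ _ i (fun z => z = m)).
apply/seteqP; split=> x /=; first by move=> -> i; exists (k x i).
by move=> hk; apply/funext => i; have [m [-> ->]] := hk i.
Qed.

Lemma meas_bfun d (T : measurableType d) (h : T -> baire) (k : nat -> nat) :
  measurable_fun setT h -> measurable_fun setT (fun x => h x \o k : baire).
Proof.
move=> mh; apply: meas_baire => i m.
exact: (@meas_coord _ _ h (k i) (fun z => z = m)).
Qed.

Definition evens (w : nat -> nat) : nat -> nat := fun i => w i.*2.
Definition odds (w : nat -> nat) : nat -> nat := fun i => w i.*2.+1.
Definition interleave (x y : nat -> nat) : nat -> nat :=
  fun i => if odd i then y i./2 else x i./2.

Lemma evens_interleave x y : evens (interleave x y) = x.
Proof. by apply/funext => i; rewrite /evens /interleave odd_double doubleK. Qed.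
Lemma odds_interleave x y : odds (interleave x y) = y.
Proof. by apply/funext => i; rewrite /odds /interleave /= odd_double /= uphalf_double. Qed.

Lemma meas_evens d (T : measurableType d) (h : T -> baire) :
  measurable_fun setT h -> measurable_fun setT (fun x => evens (h x) : baire).
Proof. exact: (@meas_bfun _ _ h double). Qed.
Lemma meas_odds d (T : measurableType d) (h : T -> baire) :
  measurable_fun setT h -> measurable_fun setT (fun x => odds (h x) : baire).
Proof. exact: (@meas_bfun _ _ h (fun i => i.*2.+1)). Qed.

End Baire.

(** * Analytic sets and Lusin separation *)

Section Analytic.
Local Open Scope classical_set_scope.

(** Closedness of a subset of the square of the Baire space, phrased through
    agreement of initial segments. *)
Definition closed2 (C : (nat -> nat) -> (nat -> nat) -> Prop) : Prop :=
  forall x u, (forall n, exists x' u', [/\ C x' u',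
    forall i, (i < n)%N -> x' i = x i & forall i, (i < n)%N -> u' i = u i]) ->
  C x u.

Definition closed_rep (A : set (nat -> nat)) : Prop :=
  exists2 C, closed2 C & forall x, A x <-> exists u, C x u.

(** The first letter of the witness says which of the sets is meant. *)
Lemma closed_rep_bigcup (A : nat -> set (nat -> nat)) :
  (forall n, closed_rep (A n)) -> closed_rep (\bigcup_n A n).
Proof.
move=> rA; have /choice[C CP] n : exists C,
    closed2 C /\ forall x, A n x <-> exists u, C x u.
  by have [C] := rA n; exists C.
exists (fun x u => C (u 0%N) x (fun i => u i.+1)).
  move=> x u lim; apply: (CP _).1 => n; have [x' [u' [Cxu ax au]]] := lim n.+1.
  exists x', (fun i => u' i.+1); split; first by rewrite -au.
    by move=> i ltin; apply: ax; exact: leqW.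
  by move=> i ltin; apply: au.
move=> x; split.
  case=> n _ /(CP n).2[u Cu]; exists (fun i => if i is j.+1 then u j else n).
  exact: Cu.
by case=> u Cu; exists (u 0%N) => //; apply/(CP _).2; exists (fun i => u i.+1).
Qed.

(** One witness codes a witness for each of the sets along a pairing of indices. *)
Lemma closed_rep_bigcap (A : nat -> set (nat -> nat)) :
  (forall n, closed_rep (A n)) -> closed_rep (\bigcap_n A n).
Proof.
move=> rA; have /choice[C CP] n : exists C,
    closed2 C /\ forall x, A n x <-> exists u, C x u.
  by have [C] := rA n; exists C.
exists (fun x u => forall j, C j x (fun k => u (pickle (j, k)))).
  move=> x u lim j; apply: (CP _).1 => n.
  (* Far enough to see the first [n] letters of the [j]-th witness. *)
  pose N := (n + \max_(k < n) (pickle (j, val k)).+1)%N.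
  have [x' [u' [Cxu ax au]]] := lim N.
  exists x', (fun k => u' (pickle (j, k))); split => // i ltin.
    by apply: ax; apply: leq_trans ltin _; exact: leq_addr.
  apply: au; apply: leq_trans (leq_addl _ _).
  exact: (@leq_bigmax _ (fun k : 'I_n => (pickle (j, val k)).+1) (Ordinal ltin)).
move=> x; split=> [Ax|[u Cu] n _]; last first.
  by apply/(CP _).2; exists (fun k => u (pickle (n, k))).
have /choice[u uP] n : exists u, C n x u by apply/(CP n).2; exact: Ax.
exists (fun k => if unpickle k is Some (j, i) then u j i else 0%N) => j.
suff -> : (fun k => if unpickle (pickle (j, k)) is Some (j, i) then u j i else 0%N)
  = u j by [].
by apply/funext => k; rewrite pickleK.
Qed.

(** The sets that are projections of closed sets, and whose complements are too,
    form a sigma-algebra that contains the cylinders. *)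
Lemma borel_closed_rep (M : set baire) : measurable M -> closed_rep M.
Proof.
suff: <<s cylinders >> `<=` [set A | closed_rep A /\ closed_rep (~` A)].
  by move=> sub /sub[].
apply: smallest_sub; last first.
  have det i (Q : nat -> Prop) : closed_rep [set x | Q (x i)].
    exists (fun x _ => Q (x i)); last by move=> x; split=> [?|[]//]; exists (fun _ => 0%N).
    by move=> x u /(_ i.+1)[x' [u' [Qx ax _]]]; rewrite -ax.
  move=> _ [i [m ->]]; split; first exact: (det i (fun k => k = m)).
  exact: (det i (fun k => k <> m)).
split=> /=.
- split.
    exists (fun _ _ => False); first by move=> x u /(_ 0%N)[? [? []]].
    by move=> x; split=> // -[].
  exists (fun _ _ => True) => // x; split=> [_|_]; first by exists x.
  by case.
- by move=> A [rA rCA]; rewrite setTD setCK.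
- move=> A rA; split; first by apply: closed_rep_bigcup => n; have [] := rA n.
  by rewrite setC_bigcup; apply: closed_rep_bigcap => n; have [] := rA n.
Qed.

Lemma meas_closed2 C d (T : measurableType d) (h k : T -> baire) :
  closed2 C -> measurable_fun setT h -> measurable_fun setT k ->
  measurable [set p | C (h p) (k p)].
Proof.
move=> cC mh mk; rewrite (_ : [set p | _] = [set p | forall n,
  exists s : seq nat * seq nat,
    (exists x u, [/\ C x u, mkseq x n = s.1 & mkseq u n = s.2])
    /\ (mkseq (h p) n = s.1 /\ mkseq (k p) n = s.2)]).
  apply: meas_all => n; apply: meas_ex => s; apply: meas_and; first exact: meas_prop.
  apply: meas_and; first exact: (@meas_coords _ _ h n (fun a => a = s.1)).
  exact: (@meas_coords _ _ k n (fun a => a = s.2)).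
apply/seteqP; split=> p /=.
  by move=> Cp n; exists (mkseq (h p) n, mkseq (k p) n); split=> //; exists (h p), (k p).
move=> lim; apply: cC => n; have [[s s'] /= [[x [u [Cxu <- <-]]] [hx ku]]] := lim n.
exists x, u; split=> // i ltin.
  by rewrite -(@nth_mkseq _ 0%N x n) // -hx nth_mkseq.
by rewrite -(@nth_mkseq _ 0%N u n) // -ku nth_mkseq.
Qed.

(** A witness that interleaves the second coordinate of a pair with a witness for
    that pair turns a projection of a projection into a single one. *)
Lemma closed2_interleave C : closed2 C ->
  closed2 (fun x u => C (interleave x (evens u)) (odds u)).
Proof.
move=> cC x u lim; apply: cC => n; have [x' [u' [Cxu ax au]]] := lim n.*2.+1.
exists (interleave x' (evens u')), (odds u'); split=> // i ltin.
  have i2 : (i./2 < n)%N.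
    by apply: leq_ltn_trans ltin; rewrite -{2}(odd_double_half i) -addnn addnCA leq_addr.
  rewrite /interleave; case: ifP => _; first by rewrite /evens au // ltnS leq_double ltnW.
  by apply: ax; rewrite ltnS -addnn (leq_trans (ltnW i2)) ?leq_addr.
by rewrite /odds au // ltnS ltn_double.
Qed.

Definition analytic (A : set (nat -> nat)) : Prop :=
  exists2 M : set (baire * baire), measurable M &
    forall x, A x <-> exists w, M (x, w).

Lemma meas_deinter : measurable_fun setT (fun w : baire => (evens w : baire, odds w : baire)).
Proof.
have mid : measurable_fun setT (id : baire -> baire) by exact: measurable_id.
by apply: measurable_fun_pair; [exact: (meas_evens mid)|exact: (meas_odds mid)].
Qed.

(** The Borel set in the plane is itself the projection of a closed set, and the
    two witnesses are merged into one. *)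
Lemma analytic_closed A : analytic A -> closed_rep A.
Proof.
case=> M mM AM.
have [C cC CP] : closed_rep [set w : baire | M (evens w, odds w)].
  apply: borel_closed_rep; exact: (meas_pre (A := M) meas_deinter mM).
exists (fun x u => C (interleave x (evens u)) (odds u)); first exact: closed2_interleave.
move=> x; split.
  move=> /AM[w Mw]; have /CP[v Cv] : M (evens (interleave x w), odds (interleave x w)).
    by rewrite evens_interleave odds_interleave.
  by exists (interleave w v); rewrite evens_interleave odds_interleave.
case=> u Cu; apply/AM; exists (evens u).
have /CP : exists v, C (interleave x (evens u)) v by exists (odds u).
by rewrite /= evens_interleave odds_interleave.
Qed.

Lemma analyticI A A' : analytic A -> analytic A' -> analytic (A `&` A').
Proof.
case=> M mM AM [M' mM' AM'].
have mid : measurable_fun setT (id : baire -> baire) by exact: measurable_id.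
have mf (k : baire -> baire) : measurable_fun setT k ->
    measurable_fun setT (fun p : baire * baire => (p.1, k p.2)).
  move=> mk; apply: measurable_fun_pair; first exact: measurable_fst.
  by apply: measurableT_comp => //; exact: measurable_snd.
exists [set p | M (p.1, evens p.2) /\ M' (p.1, odds p.2)].
  apply: meas_and.
    exact: (meas_pre (A := M) (mf evens (meas_evens mid)) mM).
  exact: (meas_pre (A := M') (mf odds (meas_odds mid)) mM').
move=> x; split=> [[/AM[w Mw] /AM'[w' Mw']]|[w [Mw M'w]]].
  by exists (interleave w w'); rewrite /= evens_interleave odds_interleave.
by split; [apply/AM; exists (evens w)|apply/AM'; exists (odds w)].
Qed.

Lemma analyticT : analytic setT.
Proof. by exists setT => //; move=> x; split=> // _; exists x. Qed.

(** Dependent choice along finite sequences. *)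
Lemma tree_branch (Q : Type) (P : seq Q -> Prop) :
  P [::] -> (forall s, P s -> exists q, P (rcons s q)) ->
  exists f : nat -> Q, forall n, P (mkseq f n).
Proof.
move=> P0 PS; have [q0 _] := PS _ P0.
have /choice[g gP] (s : seq Q) : exists q, P s -> P (rcons s q).
  by have [/PS[q]|] := pselect (P s); [exists q|exists q0].
pose sq n := iter n (fun s => rcons s (g s)) [::].
exists (g \o sq) => n; suff [<-] : sq n = mkseq (g \o sq) n /\ P (sq n) by [].
elim: n => [|n [IHn Pn]]; first by [].
by split; [rewrite mkseqS -IHn|exact: gP].
Qed.

Definition borel_sep (A B : set (nat -> nat)) : Prop :=
  exists S : set baire, [/\ measurable S, A `<=` S & forall x, B x -> ~ S x].

(** If two projections of closed sets cannot be separated, then one can extend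
    the approximations of a point and a witness on both sides by one letter at a
    time and keep the traces of the two sets inseparable. In the limit the
    closed sets contain the two branches, whose points differ at some coordinate
    because the sets are disjoint. A cylinder on that coordinate separates the
    traces, which is a contradiction. *)
Theorem lusin_separation A B : analytic A -> analytic B ->
  (forall x, A x -> B x -> False) -> borel_sep A B.
Proof.
move=> /analytic_closed[C cC CP] /analytic_closed[D cD DP] AB.
pose Q := ((nat * nat) * (nat * nat))%type; pose q0 : Q := (0, 0, (0, 0))%N.
pose E (pr : Q -> nat * nat) (F : (nat -> nat) -> (nat -> nat) -> Prop) (t : seq Q) :=
  [set x | exists u, F x u /\ forall i, (i < size t)%N -> (x i, u i) = pr (nth q0 t i)].
have Estep pr F t x : E pr F t x -> exists a, forall q, pr q = a ->
    E pr F (rcons t q) x.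
  case=> u [Fxu xt]; exists (x (size t), u (size t)) => q prq; exists u; split=> // i.
  rewrite size_rcons nth_rcons ltnS leq_eqVlt => /predU1P[->|ltit].
    by rewrite ltnn eqxx.
  by rewrite ltit xt.
have sep_step t : (forall q, borel_sep (E fst C (rcons t q)) (E snd D (rcons t q))) ->
    borel_sep (E fst C t) (E snd D t).
  move=> /choice[S SP]; exists [set x | exists a, forall b, S (a, b) x]; split.
  - by apply: meas_ex => a; apply: meas_all => b; have [] := SP (a, b).
  - move=> x /Estep[a Ea]; exists a => b; have [_ + _] := SP (a, b); apply.
    exact: Ea.
  - move=> x /Estep[b Eb] [a Sa]; have [_ _ dis] := SP (a, b).
    by apply: (dis x); [exact: Eb|exact: Sa].
apply: contrapT => nsep.
have [||f fP] := @tree_branch Q (fun t => ~ borel_sep (E fst C t) (E snd D t)).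
- move=> [S [mS AS BS]]; apply: nsep; exists S; split=> // x.
    by move=> /CP[u Cu]; apply: AS; exists u.
  by move=> /DP[u Du]; apply: BS; exists u.
- move=> t nt; apply: contrapT => nq; apply/nt/sep_step => q.
  by apply: contrapT => nsq; apply: nq; exists q.
have limit pr F : closed2 F -> (forall n, exists x, E pr F (mkseq f n) x) ->
    F (fun i => (pr (f i)).1) (fun i => (pr (f i)).2).
  move=> cF ne; apply: cF => n; have [x [u [Fxu xt]]] := ne n; exists x, u.
  have xf i : (i < n)%N -> (x i, u i) = pr (f i).
    by move=> ltin; rewrite xt ?size_mkseq // nth_mkseq.
  by split=> // i /xf <-.
have CL : C (fun i => (f i).1.1) (fun i => (f i).1.2).
  apply: (limit fst) => // n; apply: contrapT => ne; apply: (fP n).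
  by exists set0; split=> // [x Ex|x _ []]; case: ne; exists x.
have DL : D (fun i => (f i).2.1) (fun i => (f i).2.2).
  apply: (limit snd) => // n; apply: contrapT => ne; apply: (fP n).
  by exists setT; split=> // x Ex; case: ne; exists x.
have [i neqi] : exists i, (f i).1.1 <> (f i).2.1.
  apply: contrapT => alleq; apply: (AB (fun i => (f i).1.1)).
    by apply/CP; exists (fun i => (f i).1.2).
  apply/DP; exists (fun i => (f i).2.2).
  rewrite (_ : (fun i => (f i).1.1) = (fun i => (f i).2.1)) //.
  by apply/funext => i; apply: contrapT => ni; apply: alleq; exists i.
apply: (fP i.+1); exists [set x | x i = (f i).1.1]; split.
- have mid : measurable_fun setT (id : baire -> baire) by exact: measurable_id.
  exact: (@meas_coord _ baire id i (fun k => k = (f i).1.1) mid).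
- by move=> x [u [_ xt]]; have := xt i; rewrite size_mkseq nth_mkseq // => /(_ (ltnSn _)) /= <-.
- move=> x [u [_ xt]] /=; move: (xt i); rewrite size_mkseq nth_mkseq // => /(_ (ltnSn _)) fi.
  by rewrite -[x i]/((x i, u i).1) fi; exact/nesym.
Qed.

End Analytic.

(** * Borel sets with countable sections *)

Section LusinNovikov.
Local Open Scope classical_set_scope.

Notation NN := (nat -> nat).
Notation Q := ((nat * nat) * nat)%type.

Lemma join_families (I : countType) (G : I -> nat -> baire -> baire) :
  (forall i n, measurable_fun setT (G i n)) ->
  exists F : nat -> baire -> baire, (forall n, measurable_fun setT (F n)) /\
    forall i n, exists m, F m = G i n.
Proof.
move=> mG; exists (fun m => if unpickle m is Some (i, n) then G i n else id).
split=> [m|i n]; last by exists (pickle (i, n)); rewrite pickleK.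
by case: unpickle => [[i n]|]; [exact: mG|exact: measurable_id].
Qed.

Variable C0 : NN -> NN -> Prop.
Hypothesis cC0 : closed2 C0.
Let C (x y v : NN) := C0 (interleave x y) v.

Let q0 : Q := (0, 0, 0)%N.
Definition triple (x y v : NN) : nat -> Q := fun i => (x i, y i, v i).
(** A node is a finite approximation of a triple made of a point of the base, a
    point of the section above it and a witness of membership. *)
Definition on_node (t : seq Q) (x y v : NN) : Prop :=
  forall i, (i < size t)%N -> triple x y v i = nth q0 t i.

Lemma on_node_mkseq n x y v : on_node (mkseq (triple x y v) n) x y v.
Proof. by move=> i; rewrite size_mkseq => ltin; rewrite nth_mkseq. Qed.

Lemma C_closed x y v : (forall n, exists x' y' v',
  C x' y' v' /\ on_node (mkseq (triple x y v) n) x' y' v') -> C x y v.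
Proof.
move=> lim; apply: cC0 => n; have [x' [y' [v' [Cxyv xyv]]]] := lim n.
have {}xyv i : (i < n)%N -> triple x' y' v' i = triple x y v i.
  by move=> ltin; rewrite xyv ?size_mkseq // nth_mkseq.
exists (interleave x' y'), v'; split=> // i ltin; last by have [] := xyv _ ltin.
have i2 : (i./2 < n)%N.
  by apply: leq_ltn_trans ltin; rewrite -{2}(odd_double_half i) -addnn addnCA leq_addr.
by rewrite /interleave; have [-> ->] := xyv _ i2.
Qed.

(** A list of nodes is a finite approximation of a perfect subset of a single
    section. It is hopeless as soon as countably many Borel functions catch,
    above each point [x], everything that one node of the list can still reach. *)
Definition coverable (l : seq (seq Q)) : Prop :=
  exists F : nat -> baire -> baire, (forall n, measurable_fun setT (F n)) /\
    forall x, exists2 t, t \in l & forall y v, C x y v -> on_node t x y v ->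
      exists n, y = F n x.

Lemma coverable_sub l l' : {subset l <= l'} -> coverable l -> coverable l'.
Proof.
move=> sub [F [mF FP]]; exists F; split=> // x.
by have [t /sub tl' tP] := FP x; exists t.
Qed.

(** Two proper extensions of a node that no point of a section satisfies at once. *)
Definition splits (t t' t'' : seq Q) : Prop :=
  [/\ prefix t t' && (size t < size t')%N, prefix t t'' && (size t < size t'')%N
    & exists i, [/\ (i < size t')%N, (i < size t'')%N &
        (nth q0 t' i).1.2 <> (nth q0 t'' i).1.2]].

Lemma analytic_node_section (r : seq Q) (F : nat -> baire -> baire) (P : NN -> Prop) :
  (forall n, measurable_fun setT (F n)) ->
  measurable [set y : baire | P y] ->
  analytic [set x | exists y v, [/\ C x y v, on_node r x y v, P y
                               & forall n, y <> F n x]].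
Proof.
move=> mF mP.
have mx : measurable_fun setT (fst : baire * baire -> baire) by exact: measurable_fst.
have mw : measurable_fun setT (snd : baire * baire -> baire) by exact: measurable_snd.
have my := meas_evens mw; have mv := meas_odds mw.
exists [set p | C p.1 (evens p.2) (odds p.2) /\ (on_node r p.1 (evens p.2) (odds p.2) /\
    (P (evens p.2) /\ forall n, evens p.2 <> F n p.1))].
  apply: meas_and.
    apply: (meas_closed2 (C := C0) (T := (baire * baire)%type)
      (h := fun p => interleave p.1 (evens p.2)) cC0 _ mv).
    apply: meas_baire => i m; rewrite /interleave.
    have [oi|oi] := boolP (odd i).
      exact: (meas_coord i./2 (fun k => k = m) my).
    exact: (meas_coord i./2 (fun k => k = m) mx).
  apply: meas_and.
    apply: meas_all => i; apply: meas_imp; first exact: meas_prop.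
    rewrite (_ : [set p | _] = [set p | (p.1 i = (nth q0 r i).1.1 /\
      evens p.2 i = (nth q0 r i).1.2) /\ odds p.2 i = (nth q0 r i).2]).
      apply: meas_and; first apply: meas_and.
      - exact: (meas_coord i (fun k => k = _) mx).
      - exact: (meas_coord i (fun k => k = _) my).
      - exact: (meas_coord i (fun k => k = _) mv).
    apply/seteqP; split=> p /=; rewrite /triple; first by move=> <-.
    by case=> -[-> ->] ->; case: nth => -[].
  apply: meas_and; first exact: (meas_pre (T := baire) (A := P) my mP).
  apply: meas_all => n; apply: meas_not.
  exact: (meas_eq_fun my (measurableT_comp (mF n) mx)).
move=> x; split.
  case=> y [v [Cx rx Py nF]]; exists (interleave y v).
  by rewrite /= evens_interleave odds_interleave.
by case=> w /= [? [? []]]; exists (evens w), (odds w).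
Qed.

Lemma analytic_all_in (l : seq (seq Q)) (A : seq Q -> set NN) :
  (forall r, analytic (A r)) -> analytic [set x | forall r, r \in l -> A r x].
Proof.
move=> aA; elim: l => [|r l IHl].
  by rewrite (_ : [set x | _] = setT); [exact: analyticT|apply/seteqP; split].
rewrite (_ : [set x | _] = A r `&` [set x | forall r, r \in l -> A r x]).
  exact: analyticI.
apply/seteqP; split=> x /=.
  move=> Ax; split; first by apply: Ax; exact: mem_head.
  by move=> s sl; apply: Ax; rewrite in_cons sl orbT.
by case=> Ar Al s; rewrite in_cons => /predU1P[->|/Al].
Qed.

(** Separating the countably many disjoint analytic sets of each row pairwise and
    taking the least index that lies on the correct side of all separations makes
    the selection Borel. *)
Lemma select_separated (A : nat -> nat -> set NN) :
  (forall i m, analytic (A i m)) ->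
  (forall i m m' x, A i m x -> A i m' x -> m = m') ->
  exists f : baire -> baire, measurable_fun setT f /\
    forall i m x, A i m x -> f x i = m.
Proof.
move=> aA dA.
have /choice[S SP] (p : nat * nat * nat) : exists S : set baire,
    [/\ measurable S, A p.1.1 p.1.2 `<=` S &
        p.1.2 <> p.2 -> forall x, A p.1.1 p.2 x -> ~ S x].
  case: p => -[i m] m'; have [<-|nm] := pselect (m = m'); first by exists setT.
  have [|S [mS SA SB]] := lusin_separation (aA i m) (aA i m'); last by exists S.
  by move=> x Am Am'; apply: nm; exact: dA Am Am'.
pose good i m x := forall m', S (i, m, m') x.
have mgood i m : measurable [set x : baire | good i m x].
  by apply: meas_all => m'; have [] := SP (i, m, m').
(* The index [k] is the least good one, or [0] when there is none. *)
pose R x i k := (good i k x /\ forall m, (m < k)%N -> ~ good i m x) \/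
                (k = 0%N /\ forall m, ~ good i m x).
have Runiq x i k k' : R x i k -> R x i k' -> k = k'.
  case=> [[gk lk]|[-> nk]] [[gk' lk']|[-> nk']] //.
  - by case: (ltngtP k k') => // [/lk'|/lk].
  - by have := nk' _ gk.
  - by have := nk _ gk'.
have /choice[g gP] (p : baire * nat) : exists k, R p.1 p.2 k.
  case: p => x i /=; have [ex|nex] := pselect (exists m, good i m x); last first.
    by exists 0%N; right; split=> // m gm; apply: nex; exists m.
  have exb : exists m, `[< good i m x >] by case: ex => m ?; exists m; apply/asboolP.
  case: (ex_minnP exb) => k /asboolP gk kmin; exists k; left; split=> // m ltmk gm.
  by have := kmin m; rewrite leqNgt ltmk => /(_ (introT (asboolP _) gm)).
exists (fun x i => g (x, i)); split.
  apply: meas_baire => i k; rewrite (_ : [set x | _] = [set x | R x i k]).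
    apply: meas_or; apply: meas_and => //.
    - by apply: meas_all => m; apply: meas_imp; [exact: meas_prop|exact: meas_not].
    - exact: meas_prop.
    - by apply: meas_all => m; exact: meas_not.
  apply/seteqP; split=> x /=; first by move=> <-; exact: (gP (x, i)).
  by apply: Runiq; exact: (gP (x, i)).
move=> i m x Ax.
have gm : good i m x by move=> m'; have [_ + _] := SP (i, m, m'); apply.
have uniq m' : good i m' x -> m' = m.
  move=> gm'; apply: contrapT => nm; have [_ _ /(_ nm)/(_ _ Ax)] := SP (i, m', m).
  by apply; exact: gm'.
by case: (gP (x, i)) => /= [[/uniq]|[_ /(_ m)]].
Qed.

(** Suppose that every splitting of [t] leaves a coverable list, and let [F] join
    all the covering families. Above a point where no node of [l] is caught by
    [F], two points of the section on [t] that avoid [F] would be separated by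
    some splitting, and the family chosen for it would catch one of the nodes. So
    there is at most one point on [t] that avoids [F]. Its value depends on the
    base point in a Borel way by Lusin separation, and adding this one function
    to [F] covers the list. *)
Lemma split_node t l : ~ coverable (t :: l) ->
  exists t' t'', splits t t' t'' /\ ~ coverable [:: t', t'' & l].
Proof.
move=> ns; apply: contrapT => H.
have /choice[G GP] (p : seq Q * seq Q) : exists F : nat -> baire -> baire,
    (forall n, measurable_fun setT (F n)) /\ (splits t p.1 p.2 ->
     forall x, exists2 s, s \in [:: p.1, p.2 & l] &
       forall y v, C x y v -> on_node s x y v -> exists n, y = F n x).
  case: p => t' t'' /=; have [sp|nsp] := pselect (splits t t' t''); last first.
    by exists (fun _ => id); split=> // n; exact: measurable_id.
  have [F [mF FP]] : coverable [:: t', t'' & l]; last by exists F.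
  by apply: contrapT => nsm; apply: H; exists t', t''.
have [F [mF FG]] := join_families (fun p => (GP p).1).
pose avoid x y := forall n, y <> F n x.
pose D r := [set x | exists y v, [/\ C x y v, on_node r x y v, True & avoid x y]].
pose A i m := [set x | exists y v, [/\ C x y v, on_node t x y v, y i = m & avoid x y]]
              `&` [set x | forall r, r \in l -> D r x].
have aA i m : analytic (A i m).
  apply: analyticI.
    apply: (@analytic_node_section t F (fun y => y i = m)) => //.
    have mid : measurable_fun setT (id : baire -> baire) by exact: measurable_id.
    exact: (meas_coord i (fun k => k = m) mid).
  apply: analytic_all_in => r; apply: (@analytic_node_section r F (fun=> True)) => //.
  exact: meas_prop.
have Auniq x y v y' v' : (forall r, r \in l -> D r x) ->
    C x y v -> on_node t x y v -> avoid x y ->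
    C x y' v' -> on_node t x y' v' -> avoid x y' -> y = y'.
  move=> Dl Cy ty ay Cy' ty' ay'; apply/funext => i; apply: contrapT => ni.
  (* Long enough to extend [t] strictly and to reach the coordinate [i]. *)
  pose N := (maxn i (size t)).+1.
  have ext u w : on_node t x u w -> prefix t (mkseq (triple x u w) N)
      && (size t < size (mkseq (triple x u w) N))%N.
    move=> tu; rewrite size_mkseq ltnS leq_maxr andbT prefixE.
    apply/eqP/(@eq_from_nth _ q0).
      by rewrite size_take size_mkseq ltnS leq_maxr.
    move=> j; rewrite size_take size_mkseq ltnS leq_maxr => ltj.
    by rewrite nth_take // nth_mkseq ?tu // ltnS ltnW // (leq_trans ltj) ?leq_maxr.
  pose p := (mkseq (triple x y v) N, mkseq (triple x y' v') N).
  have sp : splits t p.1 p.2.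
    split; [exact: ext|exact: ext|exists i].
    by rewrite !size_mkseq !nth_mkseq ltnS leq_maxl.
  have [s + sP] := (GP p).2 sp x.
  have GF n : exists m, F m x = G p n x by have [m mn] := FG p n; exists m; rewrite mn.
  rewrite !inE => /or3P[/eqP es|/eqP es|sl].
  - have [|n yG] := sP y v Cy; first by rewrite es; exact: on_node_mkseq.
    by have [m mn] := GF n; apply: (ay m); rewrite mn.
  - have [|n yG] := sP y' v' Cy'; first by rewrite es; exact: on_node_mkseq.
    by have [m mn] := GF n; apply: (ay' m); rewrite mn.
  - have [y1 [v1 [Cy1 sy1 _ ay1]]] := Dl _ sl.
    have [n yG] := sP y1 v1 Cy1 sy1.
    by have [m mn] := GF n; apply: (ay1 m); rewrite mn.
have [|f [mf fP]] := select_separated aA.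
  move=> i m m' x [[y [v [Cy ty <- ay]]] Dl] [[y' [v' [Cy' ty' <- ay']]] _].
  by rewrite (Auniq x y v y' v').
apply: ns; exists (fun n => if n is k.+1 then F k else f); split.
  by case.
move=> x; have [Dl|] := pselect (forall r, r \in l -> D r x).
  exists t; first exact: mem_head.
  move=> y v Cy ty; have [ay|] := pselect (avoid x y).
    exists 0%N; apply/funext => i; apply/esym/fP; split=> //.
    by exists y, v.
  by move=> /existsNP[n /contrapT yF]; exists n.+1.
move=> /existsNP[r /not_implyP[rl nD]]; exists r; first by rewrite in_cons rl orbT.
move=> y v Cy ry; have [ay|] := pselect (avoid x y).
  by case: nD; exists y, v.
by move=> /existsNP[n /contrapT yF]; exists n.+1.
Qed.

(** The new nodes are put behind the ones that still have to be split. *)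
Lemma split_all todo l : ~ coverable (todo ++ l) ->
  exists2 l', ~ coverable l' & {subset l <= l'} /\ forall t, t \in todo ->
    exists t' t'', [/\ t' \in l', t'' \in l' & splits t t' t''].
Proof.
elim: todo l => [|t todo IH] l ns; first by exists l => //; split.
have [t' [t'' [sp ns']]] := split_node ns.
have [|l' nl' [sub tP]] := IH [:: t', t'' & l].
  apply: contra_not ns'; apply: coverable_sub => s.
  rewrite !(mem_cat, in_cons).
  by case: (s \in todo); case: (s == t'); case: (s == t'').
exists l' => //; split; first by move=> s sl; apply: sub; rewrite !inE sl !orbT.
move=> s; rewrite in_cons => /predU1P[->|/tP//]; exists t', t''.
by split=> //; apply: sub; rewrite !inE eqxx ?orbT.
Qed.

Lemma chain_limit (t : nat -> seq Q) :
  (forall n, prefix (t n) (t n.+1) && (size (t n) < size (t n.+1))%N) ->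
  exists q : nat -> Q, (forall n, (n <= size (t n))%N) /\
    forall n i, (i < size (t n))%N -> nth q0 (t n) i = q i.
Proof.
move=> tS; exists (fun i => nth q0 (t i.+1) i).
have szt n : (n <= size (t n))%N.
  by elim: n => // n IHn; have /andP[_] := tS n; exact: leq_ltn_trans.
have pre n m : (n <= m)%N -> prefix (t n) (t m).
  move=> /subnK <-; elim: (m - n)%N => [|k IHk]; first exact: prefix_refl.
  by have /andP[+ _] := tS (k + n)%N; exact: prefix_trans.
have nthE n m i : (n <= m)%N -> (i < size (t n))%N -> nth q0 (t n) i = nth q0 (t m) i.
  by move=> /pre/prefixP[s ->] it; rewrite nth_cat it.
split=> // n i it; case: (leqP n i.+1) => [nm|/ltnW mn]; first exact: nthE.
by rewrite (nthE i.+1 n) //; exact: szt.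
Qed.

(** Otherwise iterated splitting yields uncoverable lists of nodes of which each
    node splits again at the next stage. All nodes of a list are realised above
    one common point, so any two branches have the same limit [x] in the base. A
    branch that avoids a given enumeration of the section above [x] leads to a
    point of that section which was not enumerated. *)
Theorem cover_by_graphs : (forall x, countable [set y | exists v, C x y v]) ->
  coverable [:: [::]].
Proof.
move=> cP; apply: contrapT => ns.
have /choice[nxt nxtP] (l : seq (seq Q)) : exists l', ~ coverable l ->
    ~ coverable l' /\ forall t, t \in l ->
    exists t' t'', [/\ t' \in l', t'' \in l' & splits t t' t''].
  have [sl|nsl] := pselect (coverable l); first by exists l.
  have [|l' nl' [_ lP]] := @split_all l [::]; first by rewrite cats0.
  by exists l'.
pose L n := iter n nxt [:: [::]].
have nL n : ~ coverable (L n) by elim: n => //= n IHn; have [] := nxtP _ IHn.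
have LP n t : t \in L n -> exists t' t'',
    [/\ t' \in L n.+1, t'' \in L n.+1 & splits t t' t''].
  by move=> tL; have [_] := nxtP _ (nL n); exact.
have /choice[X XP] n : exists x, forall t, t \in L n ->
    exists y v, C x y v /\ on_node t x y v.
  apply: contrapT => nx; apply: (nL n); exists (fun _ => id).
  split; first by move=> _; exact: measurable_id.
  move=> x; move: nx => /forallNP/(_ x)/existsNP[t /not_implyP[tL nt]].
  by exists t => // y v Cy ty; case: nt; exists y, v.
have branch (z : nat -> NN) : exists t : nat -> seq Q, (forall n, t n \in L n) /\
    forall n, (prefix (t n) (t n.+1) && (size (t n) < size (t n.+1))%N) /\
      exists2 i, (i < size (t n.+1))%N & (nth q0 (t n.+1) i).1.2 <> z n i.
  have /choice[s sP] (p : nat * seq Q) : exists t', p.2 \in L p.1 ->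
      [/\ t' \in L p.1.+1, prefix p.2 t' && (size p.2 < size t')%N
        & exists2 i, (i < size t')%N & (nth q0 t' i).1.2 <> z p.1 i].
    case: p => n t /=; have [tL|ntL] := boolP (t \in L n); last by exists t.
    have [t' [t'' [t'L t''L [pt' pt'' [i [it' it'' ne]]]]]] := LP _ _ tL.
    have [e|ne'] := pselect ((nth q0 t' i).1.2 = z n i).
      by exists t'' => _; split=> //; exists i => // e'; apply: ne; rewrite e e'.
    by exists t' => _; split=> //; exists i.
  pose T := fix T n := if n is m.+1 then s (m, T m) else [::].
  have TL n : T n \in L n.
    elim: n => [|n IHn]; first exact: mem_head.
    by have [] := sP (n, T n) IHn.
  by exists T; split=> // n; have [] := sP (n, T n) (TL n).
(* An arbitrary branch serves to define the base point. *)
have [t0 [t0L t0P]] := branch (fun _ _ => 0%N).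
have [q [szq qP]] := chain_limit (fun n => (t0P n).1).
pose x i := (q i).1.1.
have Xx n i : (i < n)%N -> X n i = x i.
  move=> ltin; have ii := leq_trans ltin (szq n).
  have [y [v [_ ty]]] := XP n _ (t0L n).
  by have := ty i ii; rewrite (qP _ _ ii) /x => <-.
have [z zP] := countable_enum x (cP x).
have [t [tL tP]] := branch z.
have [p [szp pP]] := chain_limit (fun n => (tP n).1).
have pE n y v : on_node (t n) (X n) y v ->
    forall i, (i < n)%N -> triple (X n) y v i = p i.
  by move=> ty i ltin; have ii := leq_trans ltin (szp n); rewrite ty // pP.
have xp i : x i = (p i).1.1.
  have [y [v [_ ty]]] := XP i.+1 _ (tL i.+1).
  by rewrite -(pE _ _ _ ty i (ltnSn i)) /= Xx.
have Cp : C x (fun i => (p i).1.2) (fun i => (p i).2).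
  apply: C_closed => n; have [y [v [Cy ty]]] := XP n _ (tL n).
  exists (X n), y, v; split=> // i; rewrite size_mkseq => ltin.
  rewrite nth_mkseq // (pE _ _ _ ty) // /triple xp.
  by case: (p i) => -[].
have [n yz] := zP _ (ex_intro _ _ Cp).
have [_ [i it]] := tP n; apply.
by rewrite -yz pP.
Qed.

End LusinNovikov.

Section Uniformization.
Local Open Scope classical_set_scope.

(** The Lusin-Novikov theorem in the form of a covering by graphs of total Borel
    functions. With total functions the domains and images of the pieces used
    later are Borel by their definition. *)
Theorem lusin_novikov (P : set (baire * baire)) : measurable P ->
  (forall x, countable [set y | P (x, y)]) ->
  exists F : nat -> baire -> baire, (forall n, measurable_fun setT (F n)) /\
    forall x y, P (x, y) -> exists n, y = F n x.
Proof.
move=> mP cP.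
have [C cC CP] : closed_rep [set w : baire | P (evens w, odds w)].
  by apply: borel_closed_rep; exact: (meas_pre (A := P) meas_deinter mP).
have PC x y : P (x, y) <-> exists v, C (interleave x y) v.
  by rewrite -CP /= evens_interleave odds_interleave.
have [|F [mF FP]] := cover_by_graphs cC.
  move=> x; rewrite (_ : [set y | _] = [set y | P (x, y)]) //.
  by apply/seteqP; split=> y /=; rewrite PC.
exists F; split=> // x y /PC[v Cv].
by have [t] := FP x; rewrite inE => /eqP -> /(_ y v Cv); apply.
Qed.

End Uniformization.

(** * Standard Borel spaces as Borel retracts of the Baire space *)

Section PolishRetract.
Local Open Scope classical_set_scope.
Local Open Scope ring_scope.

Variables (R : realType) (P : completePseudoMetricType R).
Hypothesis polP : polish P.

Let rk (k : nat) : R := k.+1%:R^-1.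

Let rk_gt0 k : 0 < rk k.
Proof. by rewrite invr_gt0. Qed.

Let rk_small (e : R) : 0 < e -> exists j, forall k, (j <= k)%N -> rk k < e.
Proof.
move=> e0; have [j _ jP] := near_infty_natSinv_lt (PosNum e0).
by exists j => k jk; exact: jP.
Qed.

Lemma dense_sequence : exists d : nat -> P,
  forall O : set P, open O -> O !=set0 -> exists n, O (d n).
Proof.
have [_ [D cD dD]] := polP; have [d dP] := countable_enum point cD.
exists d => O oO O0; have [y [Oy /dP[n yn]]] := dD _ O0 oO.
by exists n; rewrite -yn.
Qed.

(** A point is coded by the sequence that gives, for each [k], the least index of a
    member of a dense sequence whose ball of radius [1 / (k + 1)] contains the
    point in its interior. Whether a sequence is such a code, and whether the
    coded point lies in a given open set, depends on countably many conditions on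
    finitely many coordinates each, so that the coding has a Borel retraction. *)
Lemma polish_retract : exists (e : borel_space P -> baire) (r : baire -> borel_space P),
  [/\ measurable_fun setT e, measurable_fun setT r & cancel e r].
Proof.
have [d dP] := dense_sequence.
have bopen (U : set P) : open U -> measurable (U : set (borel_space P)).
  by move=> oU; exact: sub_sigma_algebra.
pose V n k := (ball (d n) (rk k))°.
have oV n k : open (V n k) by exact: open_interior.
have Vball n k : V n k `<=` ball (d n) (rk k) by exact: interior_subset.
have cover x k : exists n, V n k x.
  have r2 : 0 < rk k / 2 by rewrite divr_gt0.
  have [n dn] := dP (ball x (rk k / 2))° (open_interior _)
    (ex_intro _ x (nbhsx_ballx x _ r2)).
  exists n; apply: filterS (nbhsx_ballx x _ r2) => y xy.
  exact: ball_splitr (interior_subset dn) xy.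
have /choice[c cP] (p : borel_space P * nat) : exists n, V n p.2 p.1 /\
    forall m, (m < n)%N -> ~ V m p.2 p.1.
  have exb : exists n, `[< V n p.2 p.1 >].
    by have [n Vn] := cover p.1 p.2; exists n; apply/asboolP.
  case: (ex_minnP exb) => n /asboolP Vn nmin; exists n; split=> // m ltmn Vm.
  by have := nmin m; rewrite leqNgt ltmn => /(_ (introT (asboolP _) Vm)).
pose e (x : borel_space P) : baire := fun k => c (x, k).
have eV x k : V (e x k) k x by exact: (cP (x, k)).1.
have e_uniq x k n : V n k x -> (forall m, (m < n)%N -> ~ V m k x) -> e x k = n.
  move=> Vn nmin; have [Ve emin] := cP (x, k); rewrite /e.
  by case: (ltngtP (c (x, k)) n) => // [/nmin|/emin].
have me : measurable_fun setT e.
  apply: meas_baire => k n; rewrite (_ : [set x | _] =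
      [set x | V n k x /\ forall m, (m < n)%N -> ~ V m k x]).
    apply: meas_and; first exact: bopen (oV n k).
    apply: meas_all => m; apply: meas_imp; first exact: meas_prop.
    by apply: meas_not; exact: bopen (oV m k).
  apply/seteqP; split=> x /=; last by case; exact: e_uniq.
  by move=> <-; have [] := cP (x, k).
(* For the code [a] of a point, [I a U] says that the point lies in the open
   set [U]. *)
pose I (a : baire) (U : set P) := exists j, ball (d (a j)) (3 * rk j) `<=` U.
have I_lim (a : baire) x (U : set P) : open U ->
    (forall j, ball (d (a j)) (3 * rk j) x) -> I a U <-> U x.
  move=> oU ax; split=> [[j]|Ux]; first by apply; exact: ax.
  have [eps /= e0 epsU] : nbhs_ball x U by apply/nbhs_ballP; exact: open_nbhs_nbhs.
  have [j jP] := rk_small (divr_gt0 e0 (ltr0n R 6)).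
  exists j => y dy; apply: epsU; apply: (@le_ball _ _ _ (3 * rk j + 3 * rk j)).
    by have := jP j (leqnn j); lra.
  by apply: (ball_triangle _ dy); apply: ball_sym; exact: ax.
have e3 x j : ball (d (e x j)) (3 * rk j) x.
  by apply: (le_ball _ (Vball _ _ _ (eV x j))); have := rk_gt0 j; lra.
(* The first condition makes [a] converge, and the second one makes [a] the code
   of its limit. *)
pose code (a : baire) := (forall i j, exists n m, (a i = n /\ a j = m) /\
    V n i `&` V m j !=set0) /\
  forall k, exists n, a k = n /\ (I a (V n k) /\ forall m, (m < n)%N -> ~ I a (V m k)).
have code_e x : code (e x).
  split=> [i j|k]; first by exists (e x i), (e x j); split=> //; exists x; split; exact: eV.
  have Ie n : I (e x) (V n k) <-> V n k x by apply: I_lim => // j; exact: e3.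
  exists (e x k); split=> //; split; first by apply/Ie; exact: eV.
  by move=> m ltm /Ie; exact: (cP (x, k)).2.
have code_im (a : baire) : code a -> exists x, e x = a.
  case=> meet ak.
  have dd i j : ball (d (a i)) (rk i + rk j) (d (a j)).
    have [n [m [[-> ->] [y [/Vball dy /Vball dy']]]]] := meet i j.
    by apply: ball_triangle dy _; exact: ball_sym.
  have cau : cauchy ((fun j => d (a j)) @ \oo).
    apply: cauchy_exP => eps e0; have [j jP] := rk_small (divr_gt0 e0 (ltr0n R 2)).
    exists (d (a j)); exists j => // k /= jk; apply: le_ball (dd j k).
    by have := jP j (leqnn j); have := jP k jk; lra.
  have /cvg_ex[x dx] : cvg ((fun j => d (a j)) @ \oo) by exact: cauchy_cvg.
  have ax i : ball (d (a i)) (3 * rk i) x.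
    have ri := rk_gt0 i.
    have [j1 _ j1P] := dx _ (nbhsx_ballx x _ ri).
    have [j2 j2P] := rk_small ri.
    pose j := maxn j1 j2; have := j1P j (leq_maxl _ _); have := j2P j (leq_maxr _ _).
    move=> rj /ball_sym xj; apply: le_ball (ball_triangle (dd i j) xj); lra.
  exists x; apply/funext => k; have [n [-> [In nI]]] := ak k.
  apply: e_uniq; first by apply/(I_lim a).
  by move=> m ltm Vm; apply: (nI m ltm); apply/(I_lim a x).
have e_inj : injective e.
  move=> x y exy; apply: contrapT => nxy.
  have [[r1 r2] /= /eqP/seteqP[sub _]] : exists r : {posnum R} * {posnum R},
      ball x r.1%:num `&` ball y r.2%:num == set0.
    by have [hP _] := polP; move: hP; rewrite ball_hausdorff; apply; apply/eqP.
  have [j1 j1P] := rk_small (gt0 r1); have [j2 j2P] := rk_small (gt0 r2).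
  pose j := maxn j1 j2; apply: (sub (d (e x j))); split; apply: ball_sym.
    by apply: (le_ball _ (Vball _ _ _ (eV x j))); apply/ltW/j1P; exact: leq_maxl.
  by rewrite exy; apply: (le_ball _ (Vball _ _ _ (eV y j))); apply/ltW/j2P; exact: leq_maxr.
have /choice[r rP] (a : baire) : exists x : borel_space P,
    (code a -> e x = a) /\ (~ code a -> x = point).
  have [ca|nca] := pselect (code a); last by exists point.
  by have [x xa] := code_im _ ca; exists x.
exists e, r; split=> //; last by move=> x; apply/e_inj/(rP _).1/code_e.
have mid : measurable_fun setT (id : baire -> baire) by exact: measurable_id.
have mI U : measurable [set a | I a U].
  apply: meas_ex => j.
  exact: (meas_coord j (fun n => ball (d n) (3 * rk j) `<=` U) mid).
have mc : measurable [set a | code a].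
  apply: meas_and.
    apply: meas_all => i; apply: meas_all => j; apply: meas_ex => n; apply: meas_ex => m.
    apply: meas_and; last exact: meas_prop.
    apply: meas_and; first exact: (meas_coord i (fun l => l = n) mid).
    exact: (meas_coord j (fun l => l = m) mid).
  apply: meas_all => k; apply: meas_ex => n; apply: meas_and.
    exact: (meas_coord k (fun l => l = n) mid).
  apply: meas_and; first exact: mI.
  apply: meas_all => m; apply: meas_imp; first exact: meas_prop.
  exact: meas_not.
apply: (@measurability _ _ _ _ setT r (@open P)) => //.
move=> _ [U oU <-]; rewrite setTI (_ : _ @^-1` _ =
  [set a | (code a /\ I a U) \/ (~ code a /\ U point)]).
  apply: meas_or; apply: meas_and => //; first exact: meas_not.
  exact: meas_prop.
have codeI (a : baire) : code a -> I a U <-> U (r a).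
  move=> ca; have ea := (rP a).1 ca.
  by apply: I_lim => // j; rewrite -{1}ea; exact: e3.
apply/seteqP; split=> a /=.
  have [ca|nca] := pselect (code a); first by move=> /(codeI _ ca); left.
  by rewrite (rP a).2 //; right.
by case=> [[ca /(codeI _ ca)]|[nca]] //; rewrite (rP a).2.
Qed.

End PolishRetract.

(** * Generating involutions of a countable Borel equivalence relation *)

Section FeldmanMoore.
Local Open Scope classical_set_scope.

Lemma standard_borel_retract (R : realType) d (X : measurableType d) :
  standard_borel R X -> exists (e : X -> baire) (r : baire -> X),
  [/\ measurable_fun setT e, measurable_fun setT r & cancel e r].
Proof.
case=> P /polish_retract[e [r [me mr er]]] [f [g [fg gf mf mg]]].
exists (e \o f), (g \o r); split; [exact: measurableT_comp|exact: measurableT_comp|].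
by move=> x /=; rewrite er fg.
Qed.

(** Let [f n] be Borel functions whose graphs cover [E]. If [f n] maps [x] to [y],
    [f m] maps [y] back to [x] and a Borel set [U] contains [x] but not [y], then
    on the Borel set of such [x] the map [f n] is injective with inverse [f m],
    and its image lies outside of [U]. Swapping along it and fixing all other
    points is a Borel involution. The sets [U] range over a countable family that
    separates points. *)
Theorem feldman_moore d (X : measurableType d) (e : X -> baire) (r : baire -> X)
    (E : X -> X -> Prop) :
  measurable_fun setT e -> measurable_fun setT r -> cancel e r ->
  (forall x, E x x) -> (forall x y, E x y -> E y x) ->
  measurable [set p : X * X | E p.1 p.2] ->
  (forall x, countable [set y | E x y]) ->
  exists g : nat -> X -> X, [/\ forall k, measurable_fun setT (g k),
    forall k, involutive (g k) & forall x y, E x y -> exists k, g k x = y].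
Proof.
move=> me mr er Exx Esym mE cE.
have mer : measurable_fun setT (fun a : baire => e (r a)) by exact: measurableT_comp.
have mfst : measurable_fun setT (fst : baire * baire -> baire) by exact: measurable_fst.
have msnd : measurable_fun setT (snd : baire * baire -> baire) by exact: measurable_snd.
pose P := [set p : baire * baire | (e (r p.1) = p.1 /\ e (r p.2) = p.2) /\ E (r p.1) (r p.2)].
have mP : measurable P.
  apply: meas_and; first apply: meas_and.
  - exact: (meas_eq_fun (measurableT_comp mer mfst) mfst).
  - exact: (meas_eq_fun (measurableT_comp mer msnd) msnd).
  - apply: (meas_pre (T := (X * X)%type) (A := fun p => E p.1 p.2)
      (f := fun p : baire * baire => (r p.1, r p.2))) mE.
    apply: measurable_fun_pair; exact: measurableT_comp.
have cP a : countable [set b | P (a, b)].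
  apply: (@sub_countable _ _ _ [set y | E (r a) y]) (cE _).
  apply: card_le_trans (card_image_le e _); apply: subset_card_le.
  by move=> b [[/= _ eb] Eab]; exists (r b).
have [F [mF FP]] := lusin_novikov mP cP.
pose f n x := r (F n (e x)).
have mf n : measurable_fun setT (f n).
  by apply: (measurableT_comp mr); exact: measurableT_comp.
have fE x y : E x y -> exists n, f n x = y.
  move=> Exy; have [|n eyF] := FP (e x) (e y); first by rewrite /P /= !er.
  by exists n; rewrite /f -eyF er.
pose U i l x := e x i = l.
have mU i l : measurable [set x | U i l x].
  exact: (meas_coord i (fun k => k = l) me).
pose D n m i l x := (f m (f n x) = x /\ U i l x) /\ ~ U i l (f n x).
have mD n m i l : measurable [set x | D n m i l x].
  apply: meas_and; first apply: meas_and => //.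
    rewrite (_ : [set x | _] = [set x | e (f m (f n x)) = e x]).
      apply: meas_eq_fun => //; apply: (measurableT_comp me).
      exact: measurableT_comp.
    apply/seteqP; split=> x /=; first by move=> ->.
    exact: (can_inj er).
  apply: meas_not; exact: (meas_pre (mf n) (mU i l)).
pose D' n m i l x := (f n (f m x) = x /\ ~ U i l x) /\ U i l (f m x).
have mD' n m i l : measurable [set x | D' n m i l x].
  apply: meas_and; first apply: meas_and.
  - rewrite (_ : [set x | _] = [set x | e (f n (f m x)) = e x]).
      apply: meas_eq_fun => //; apply: (measurableT_comp me).
      exact: measurableT_comp.
    apply/seteqP; split=> x /=; first by move=> ->.
    exact: (can_inj er).
  - exact: meas_not.
  - exact: (meas_pre (mf m) (mU i l)).
(* The swap along [f n] on [D] and along [f m] on its image, which is [D']. *)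
pose h (q : nat * nat * nat * nat) x := let: (n, m, i, l) := q in
  if `[< D n m i l x >] then f n x else if `[< D' n m i l x >] then f m x else x.
have mh q : measurable_fun setT (h q).
  case: q => -[[n m] i] l; rewrite /h.
  have mB (A : X -> Prop) : measurable [set x | A x] ->
      measurable_fun setT (fun x => `[< A x >]).
    move=> mA; apply: (measurable_fun_bool true).
    rewrite setTI (_ : _ @^-1` _ = [set x | A x]) //.
    by apply/seteqP; split=> x /= /asboolP.
  apply: measurable_fun_ifT; [exact: mB|exact: mf|].
  by apply: measurable_fun_ifT; [exact: mB|exact: mf|exact: measurable_id].
have hD n m i l x : D n m i l x -> h (n, m, i, l) x = f n x.
  by rewrite /h => Dx; case: asboolP.
have hD' n m i l x : D' n m i l x -> h (n, m, i, l) x = f m x.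
  rewrite /h => Dx; case: asboolP => [Dx'|_]; last by case: asboolP.
  by case: Dx' => -[_ Ux] _; case: Dx => -[_ []].
have hK q : involutive (h q).
  case: q => -[[n m] i] l x.
  have [Dx|nD] := pselect (D n m i l x).
    rewrite (hD _ _ _ _ x) // hD'; first by case: Dx => -[].
    by case: Dx => -[fx Ux] nU; split; [split; rewrite ?fx|rewrite fx].
  have [Dx|nD'] := pselect (D' n m i l x).
    rewrite (hD' _ _ _ _ x) // hD; first by case: Dx => -[].
    by case: Dx => -[fx Ux] nU; split; [split; rewrite ?fx|rewrite fx].
  suff hx : h (n, m, i, l) x = x by rewrite !hx.
  by rewrite /h; case: asboolP => // _; case: asboolP.
exists (fun k => if unpickle k is Some q then h q else id); split.
- by move=> k; case: unpickle => [q|]; [exact: mh|exact: measurable_id].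
- by move=> k; case: unpickle => // q; exact: hK.
move=> x y Exy; have [<-|nxy] := pselect (x = y).
  have [n fn] := fE _ _ (Exx x).
  exists (pickle (n, n, 0%N, 0%N)); rewrite pickleK /h.
  by case: asboolP => // _; case: asboolP.
have [n fn] := fE _ _ Exy; have [m fm] := fE _ _ (Esym _ _ Exy).
have [i nei] : exists i, e x i <> e y i.
  apply: contrapT => ne; apply: nxy; apply: (can_inj er); apply/funext => i.
  by apply: contrapT => nei; apply: ne; exists i.
exists (pickle (n, m, i, e x i)); rewrite pickleK hD ?fn //.
by split; [split; rewrite ?fn|rewrite fn; exact/nesym].
Qed.

End FeldmanMoore.

(** * Positive cones of bi-orderings of quotients *)

Section Cones.
Local Open Scope group_scope.

(** The elements of [G] whose images are positive for a bi-ordering of the quotient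
    of [G] by [N]. *)
Definition quotient_cone (G : groupType) (N P : G -> Prop) : Prop :=
  [/\ forall x, N x -> ~ P x,
      forall x y, P x -> P y -> P (x * y),
      forall x y, P x -> P (x ^ y)
    & forall x, [\/ N x, P x | P x^-1]].

Variables (G : groupType) (N : normal_subgroup G).

Lemma cone_bi_orderable P : quotient_cone (ns_set N) P ->
  bi_orderable (quotient_group N).
Proof.
case=> PN PM PJ Ptot; have [N1 NM NV NJ] := ns_normal N.
have shift x y : ns_set N (x^-1 * y) -> P x -> P y.
  move=> Nxy Px; have [Ny|//|PVy] := Ptot y; exfalso.
    apply: (PN x) => //; rewrite -[x](mulVKg y) -[y^-1 * x]invgK.
    by apply: NM => //; apply: NV; rewrite invgM invgK.
  apply: (PN (y^-1 * x)); last exact: PM.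
  by rewrite -[y^-1 * x]invgK; apply: NV; rewrite invgM invgK.
pose lt (a b : quotient_group N) := P ((repr a)^-1 * repr b).
have ltE x y : lt (coset_pi N x) (coset_pi N y) <-> P (x^-1 * y).
  rewrite /lt; set a := repr _; set b := repr _.
  have ab : coset_pi N (a^-1 * b) = coset_pi N (x^-1 * y).
    by rewrite -!qmulE -!qinvE !coset_reprK.
  by split; apply: shift; apply/coset_piP.
exists lt; split.
- split=> [a|a b c]; rewrite -(coset_reprK a); first by move=> /ltE; rewrite mulVg; exact: PN.
  rewrite -(coset_reprK b) -(coset_reprK c) => /ltE Pab /ltE Pbc; apply/ltE.
  by have := PM _ _ Pab Pbc; rewrite mulgA mulgK.
- move=> a b; rewrite -(coset_reprK a) -(coset_reprK b) => ab.
  have [/coset_piP//|Pab|] := Ptot ((repr a)^-1 * repr b).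
    by left; apply/ltE.
  by rewrite invgM invgK => Pba; right; apply/ltE.
- move=> c a b; rewrite -(coset_reprK a) -(coset_reprK b) -(coset_reprK c) => /ltE Pab.
  by rewrite -!coset_piM; apply/ltE; rewrite invgM -mulgA mulKg.
- move=> c a b; rewrite -(coset_reprK a) -(coset_reprK b) -(coset_reprK c) => /ltE Pab.
  rewrite -!coset_piM; apply/ltE; rewrite invgM.
  by have := PJ _ (repr c) Pab; rewrite /conjg !mulgA.
Qed.

Lemma bi_orderable_cone : bi_orderable (quotient_group N) ->
  exists P, quotient_cone (ns_set N) P.
Proof.
case=> lt [[irr tr] tot ltl ltr]; have pi1 : coset_pi N 1 = 1 by [].
exists (fun x => lt 1 (coset_pi N x)); split.
- move=> x Nx; rewrite (_ : coset_pi N x = 1); first exact: irr.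
  apply/esym; rewrite -pi1; apply/coset_piP.
  by rewrite invg1 mul1g.
- move=> x y Px Py; apply: tr Px _; rewrite coset_piM -{1}[coset_pi N x]mulg1.
  exact: ltl.
- move=> x y Px; have := ltr (coset_pi N y) _ _ (ltl (coset_pi N y^-1) _ _ Px).
  have -> : coset_pi N (x ^ y) = coset_pi N y^-1 * coset_pi N x * coset_pi N y.
    by rewrite /conjg !coset_piM mulgA.
  by rewrite mulg1 -[in X in X -> _](coset_piM N y^-1 y) mulVg pi1.
- move=> x; have [e|ne] := pselect (1 = coset_pi N x).
    by constructor 1; move: e; rewrite -pi1 => /coset_piP; rewrite invg1 mul1g.
  have [lx|xl] := tot _ _ ne; first by constructor 2.
  constructor 3; have := ltl (coset_pi N x^-1) _ _ xl.
  by rewrite mulg1 -coset_piM mulVg.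
Qed.

End Cones.

Section WordFold.
Variables (A : choiceType) (T : Type) (phi : letter A -> T -> T).
Hypothesis phiK : forall l x, phi l (phi (letter_inv l) x) = x.

(** Free reduction does not change the effect of a word when inverse letters act
    by inverse maps. *)
Lemma foldr_act_word u w x :
  foldr phi x (act_word u w) = foldr phi (foldr phi x w) u.
Proof.
elim: u => //= l u <-; case: (act_word u w) => [|m v] //=.
by case: eqP => [->|_] //=; rewrite phiK.
Qed.

End WordFold.

(** * A bi-ordering of the free group of rank two *)

Section Sanov.
Local Open Scope ring_scope.

Notation Mat := 'M[{poly int}]_2.

Definition coord_of (b : bool) : 'I_2 := if b then 0 else 1.

Definition sign_of (b : bool) : int := if b then 1 else -1.

(** The two generators become the elementary matrices with off-diagonal entry
    the variable ['X], hence congruent to the identity modulo ['X]. *)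
Definition letter_mx (l : letter bool) : Mat :=
  1 + ((sign_of l.2)%:P * 'X) *: delta_mx (coord_of l.1) (coord_of (~~ l.1)).

Lemma letter_mxK l : letter_mx l * letter_mx (letter_inv l) = 1.
Proof.
case: l => a b; rewrite /letter_mx /=.
rewrite mulrDl mul1r mulrDr mulr1 -scalerAl -scalerAr.
rewrite -mulmxE mul_delta_mx_0; last by case: a.
rewrite !scaler0 addr0 -addrA -scalerDl -mulrDl -polyCD.
by case: b; rewrite mul0r scale0r addr0.
Qed.

Definition word_mx (w : seq (letter bool)) : Mat :=
  foldr (fun l M => letter_mx l * M) 1 w.

Lemma word_mxM u w : word_mx (act_word u w) = word_mx u * word_mx w.
Proof.
rewrite /word_mx foldr_act_word; last by move=> l x; rewrite mulrA letter_mxK mul1r.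
elim: u => [|l u IHu] /=; first by rewrite mul1r.
by rewrite IHu mulrA.
Qed.

Definition sanov (x : free_group bool) : Mat := word_mx (word_of x).

Lemma sanovM : {morph sanov : x y / (x * y)%g >-> x * y}.
Proof. by move=> x y; exact: word_mxM. Qed.

Lemma sanovV x : sanov x^-1%g * sanov x = 1.
Proof. by rewrite -sanovM mulVg. Qed.

(** The attracting region of the letter [l] for the ping-pong below: the
    coordinate that [l] modifies has degree one more than the other one, and the
    product of the leading coefficients has the sign of the exponent of [l]. *)
Definition leads (l : letter bool) (v : 'cV[{poly int}]_2) : Prop :=
  let p := v (coord_of l.1) 0 in let q := v (coord_of (~~ l.1)) 0 in
  exists n, [/\ (size p <= n.+2)%N, (size q <= n.+1)%N &
                0 < sign_of l.2 * p`_n.+1 * q`_n].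

Lemma letter_mx_col l (v : 'cV[{poly int}]_2) :
  (letter_mx l *m v) (coord_of l.1) 0 =
    v (coord_of l.1) 0 + (sign_of l.2)%:P * 'X * v (coord_of (~~ l.1)) 0 /\
  (letter_mx l *m v) (coord_of (~~ l.1)) 0 = v (coord_of (~~ l.1)) 0.
Proof.
case: l => a b /=; rewrite /letter_mx mulmxDl mul1mx -scalemxAl.
rewrite ![fun_of_matrix (_ + _) _ _]mxE ![fun_of_matrix (_ *: _) _ _]mxE.
have dE i : (delta_mx (coord_of a) (coord_of (~~ a)) *m v) i 0 =
    (i == coord_of a)%:R * v (coord_of (~~ a)) 0.
  rewrite mxE (bigD1 (coord_of (~~ a))) //= big1 ?addr0 ?mxE ?eqxx ?andbT //.
  by move=> j ne; rewrite mxE (negbTE ne) andbF mul0r.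
rewrite !dE eqxx mul1r; split=> //.
by rewrite (_ : (_ == _) = false) ?mul0r ?mulr0 ?addr0 //; case: (a).
Qed.

(** Ping-pong, starting from the vector with both coordinates [1]. A letter
    followed by itself cannot cancel leading terms since their signs agree, and a
    letter after a different generator raises the degree of the coordinate that
    was dominated. *)
Lemma leads_word l w : reduced (l :: w) ->
  leads l (word_mx (l :: w) *m (const_mx 1 : 'cV_2)).
Proof.
elim: w l => [|m w IHw] l.
  move=> _; rewrite /leads /= mulr1.
  have [-> ->] := letter_mx_col l (const_mx 1 : 'cV_2); rewrite !mxE mulr1.
  exists 0%N; split.
  - rewrite (leq_trans (size_polyD _ _)) // geq_max size_poly1 /=.
    by rewrite (leq_trans (size_polyMleq _ _)) // size_polyX size_polyC; case: (l.2).
  - by rewrite size_poly1.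
  - by rewrite coefD coefCM coefX !coef1 /= add0r mulr1 mulr1; case: (l.2).
move=> rlw; have /andP[nm rw] : (m != letter_inv l) && reduced (m :: w) := rlw.
rewrite [word_mx _](_ : _ = letter_mx l *m word_mx (m :: w)) // -mulmxA.
move: (word_mx (m :: w) *m _) (IHw m rw) => v; rewrite /leads.
have [-> ->] := letter_mx_col l v.
case=> n [sp sq lead].
have XE (q : {poly int}) k : ((sign_of l.2)%:P * 'X * q)`_k.+1 = sign_of l.2 * q`_k.
  by rewrite -mulrA coefCM -commr_polyX coefMX.
have Xs (q : {poly int}) k : (size q <= k)%N ->
    (size ((sign_of l.2)%:P * 'X * q)%R <= k.+1)%N.
  move=> sqk; apply/leq_sizeP => -[|j] // kj.
  by rewrite XE nth_default ?mulr0 // (leq_trans sqk).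
have sgsg b : sign_of b * sign_of b = 1 by case: b.
have [e|ne] := eqVneq m.1 l.1.
  have {nm} e2 : m.2 = l.2.
    move: nm e; rewrite /letter_inv; case: (m) => a b; case: (l) => c d /= nm ac.
    by move: nm; rewrite ac xpair_eqE eqxx /=; case: b; case: d.
  rewrite e e2 in sp sq lead.
  exists n; split=> //.
    by rewrite (leq_trans (size_polyD _ _)) // geq_max sp /= Xs.
  rewrite coefD XE; move: lead; set a := _`_n.+1; set b := _`_n.
  have b2 : 0 <= b * b by rewrite -expr2 sqr_ge0.
  have -> : sign_of l.2 * (a + sign_of l.2 * b) * b =
      sign_of l.2 * a * b + (sign_of l.2 * sign_of l.2) * (b * b) by ring.
  by rewrite sgsg mul1r => lt0; rewrite ltr_wpDr.
have e1 : m.1 = ~~ l.1 by move: ne; case: (m.1) (l.1) => [] [].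
rewrite e1 negbK in sp sq lead.
exists n.+1; split=> //.
  by rewrite (leq_trans (size_polyD _ _)) // geq_max Xs // (leq_trans sq) // ltnW.
rewrite coefD XE nth_default ?add0r; last by rewrite (leq_trans sq) // ltnW.
rewrite mulrA sgsg mul1r -expr2 lt0r sqr_ge0 andbT expf_neq0 //.
by apply/eqP => z; move: lead; rewrite z mulr0 mul0r ltxx.
Qed.

Lemma sanov_inj1 x : sanov x = 1 -> x = 1%g.
Proof.
case: x => -[|l w] rw; first by move=> _; apply: val_inj.
rewrite /sanov => x1; have := leads_word rw; rewrite -[word_mx _]/(word_mx (l :: w)) x1.
rewrite mul1mx /leads !mxE => -[n [_ _]].
by rewrite coef1 mulr0 mul0r ltxx.
Qed.

Definition ev0 (K : Mat) : 'M[int]_2 := map_mx (horner_eval 0) K.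

Lemma ev0M K L : ev0 (K * L) = ev0 K * ev0 L.
Proof. exact: map_mxM. Qed.
Lemma ev0D K L : ev0 (K + L) = ev0 K + ev0 L.
Proof. exact: map_mxD. Qed.
Lemma ev0N K : ev0 (- K) = - ev0 K.
Proof. exact: map_mxN. Qed.
Lemma ev01 : ev0 1 = 1.
Proof. exact: map_mx1. Qed.
Lemma ev0X k (K : Mat) : ev0 ('X^(k.+1) *: K)%R = 0.
Proof. by apply/matrixP => i j; rewrite !mxE /horner_eval hornerM hornerXn expr0n mul0r. Qed.

Definition lexpos (A : 'M[int]_2) : Prop :=
  0 < A 0 0 \/ A 0 0 = 0 /\ (0 < A 0 1 \/ A 0 1 = 0 /\ (0 < A 1 0 \/
    A 1 0 = 0 /\ 0 < A 1 1)).

Lemma lexposD A B : lexpos A -> lexpos B -> lexpos (A + B).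
Proof. by rewrite /lexpos !mxE; lra. Qed.

Lemma lexpos_total A : A <> 0 -> lexpos A \/ lexpos (- A).
Proof.
move=> A0; rewrite /lexpos !mxE.
have : ~ [/\ A 0 0 = 0, A 0 1 = 0, A 1 0 = 0 & A 1 1 = 0].
  move=> [a b c d]; apply: A0; apply/matrixP => i j; rewrite mxE.
  have I2 (k : 'I_2) : k = 0 \/ k = 1.
    by case: k => [[|[|]]] // ?; [left|right]; exact: val_inj.
  by case: (I2 i) (I2 j) => [] -> [] ->.
case: (ltrgt0P (A 0 0)) => [? _|? _|->]; first by left; left.
  by right; left; lra.
case: (ltrgt0P (A 0 1)) => [? _|? _|->]; first by left; right; split=> //; left.
  by right; right; split; [lra|left; lra].
case: (ltrgt0P (A 1 0)) => [? _|? _|->].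
- by left; right; split=> //; right; split=> //; left.
- by right; right; split; [lra|right; split; [lra|left; lra]].
case: (ltrgt0P (A 1 1)) => [? _|? _|-> []//].
- by left; right; split=> //; right; split=> //; right.
- by right; right; split; [lra|right; split; [lra|right; split; lra]].
Qed.

(** The lowest homogeneous part of [M - 1], as a polynomial in ['X] with matrix
    coefficients, is positive. Since all matrices concerned are [1] modulo ['X],
    conjugation does not change this part. In a product the part of lower degree
    survives, or the sum of the two parts if their degrees agree. *)
Definition mxpos (M : Mat) : Prop :=
  exists d (K : Mat), M = 1 + 'X^(d.+1) *: K /\ lexpos (ev0 K).

Lemma mxposM M L : mxpos M -> mxpos L -> mxpos (M * L).
Proof.
case=> d [K [-> pK]] [e [H [-> pH]]].
have E : (1 + 'X^(d.+1) *: K) * (1 + 'X^(e.+1) *: H) =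
   1 + ('X^(d.+1) *: K + 'X^(e.+1) *: H + ('X^(d.+1) * 'X^(e.+1)) *: (K * H)).
  by rewrite mulrDl mul1r mulrDr mulr1 -scalerAl -scalerAr scalerA -!addrA
    [X in 1 + X]addrCA.
rewrite E; case: (ltngtP d e) => de.
- exists d, (K + ('X^((e - d.+1).+1) *: H + 'X^(e.+1) *: (K * H))).
  rewrite !ev0D !ev0X !addr0; split=> //; congr (1 + _).
  rewrite !scalerDr !scalerA -!exprD addrA; congr (_ + _ *: _ + _).
  by congr ('X^_); rewrite addnS subnKC.
- exists e, (H + ('X^((d - e.+1).+1) *: K + 'X^(d.+1) *: (K * H))).
  rewrite !ev0D !ev0X !addr0; split=> //; congr (1 + _).
  rewrite !scalerDr !scalerA -!exprD [in RHS]addrCA !addrA; congr (_ *: _ + _ + _ *: _).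
    by congr ('X^_); rewrite addnS subnKC.
  by rewrite addnC.
- exists d, (K + H + 'X^(e.+1) *: (K * H)); rewrite !ev0D !ev0X addr0.
  by split; [rewrite -de !scalerDr !scalerA|exact: lexposD].
Qed.

Lemma mxposJ M U V : V * U = 1 -> ev0 U = 1 -> ev0 V = 1 -> mxpos M -> mxpos (V * M * U).
Proof.
move=> VU U1 V1 [d [K [-> pK]]]; exists d, (V * K * U).
rewrite !ev0M U1 V1 mulr1 mul1r; split=> //.
by rewrite mulrDr mulrDl mulr1 VU -scalerAr -scalerAl.
Qed.

(** The power of ['X] is the least order of vanishing at [0] among the entries. *)
Lemma factor_X (A : Mat) : A <> 0 -> exists d (K : Mat), A = 'X^d *: K /\ ev0 K <> 0.
Proof.
have [n] : exists n, forall i j, (size (A i j) <= n)%N.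
  exists (\max_i \max_j size (A i j)) => i j.
  apply: leq_trans (leq_bigmax i); exact: (leq_bigmax j).
elim: n A => [|n IHn] A sA A0.
  by case: A0; apply/matrixP => i j; rewrite mxE; apply/eqP; rewrite -size_poly_leq0.
have [ez|nz] := pselect (ev0 A = 0); last by exists 0%N, A; rewrite expr0 scale1r.
pose B := \matrix_(i, j) drop_poly 1 (A i j) : Mat.
have AB : A = 'X *: B.
  apply/matrixP => i j; rewrite !mxE.
  have /matrixP/(_ i j) := ez; rewrite !mxE /horner_eval => Aij0.
  rewrite -{1}(poly_take_drop 1 (A i j)) expr1 mulrC.
  suff -> : take_poly 1 (A i j) = 0 by rewrite add0r.
  by apply/polyP => -[|k]; rewrite coef_take_poly coef0 //= -horner_coef0.
have [|B0|d [K [BK K0]]] := IHn B.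
- by move=> i j; rewrite mxE size_drop_poly leq_subLR add1n.
- by apply: A0; rewrite AB B0 scaler0.
by exists d.+1, K; rewrite AB BK scalerA -exprS.
Qed.

Lemma ev0_sanov x : ev0 (sanov x) = 1.
Proof.
case: x => w rw; rewrite /sanov /=; elim: w {rw} => [|l w IHw]; first exact: ev01.
rewrite /= ev0M IHw mulr1 ev0D ev01 -['X]expr1 mulrC -scalerA ev0X.
by rewrite addr0.
Qed.

Definition free_pos (x : free_group bool) : Prop := mxpos (sanov x).

Lemma free_posM x y : free_pos x -> free_pos y -> free_pos (x * y)%g.
Proof. by rewrite /free_pos sanovM; exact: mxposM. Qed.

Lemma free_posJ x y : free_pos x -> free_pos (x ^ y)%g.
Proof.
rewrite /free_pos /conjg !sanovM mulrA; apply: mxposJ; rewrite ?ev0_sanov //.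
exact: sanovV.
Qed.

Lemma free_pos_neq1 x : free_pos x -> x <> 1%g.
Proof.
move=> [d [K [E pK]]] x1; have /matrixP K0 : 'X^(d.+1) *: K = 0.
  by apply: (addrI 1); rewrite -E x1 addr0.
move: pK; suff -> : K = 0.
  by rewrite /lexpos !mxE /horner_eval horner0; lra.
apply/matrixP => i j; have /eqP := K0 i j; rewrite !mxE mulf_eq0.
by rewrite expf_eq0 polyX_eq0 andbF => /eqP.
Qed.

Lemma free_pos_total x : [\/ x = 1%g, free_pos x | free_pos x^-1%g].
Proof.
have [->|nx1] := pselect (x = 1%g); first by constructor 1.
have [|d [K [MK K0]]] := @factor_X (sanov x - 1).
  by move/subr0_eq/sanov_inj1.
case: d MK => [|d] MK.
  case: K0; rewrite -[K]scale1r -(expr0 'X) -MK ev0D ev0N ev0_sanov ev01.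
  by rewrite subrr.
have [pK|pK] := lexpos_total K0.
  by constructor 2; exists d, K; split=> //; rewrite -MK addrC subrK.
constructor 3; exists d, (- (sanov x^-1%g * K)).
rewrite ev0N ev0M ev0_sanov mul1r; split=> //.
by rewrite scalerN scalerAr -MK mulrBr sanovV mulr1 opprB addrC subrK.
Qed.

End Sanov.

(** * Morphisms and subdirect products *)

Section Morphisms.
Local Open Scope group_scope.

Lemma morph1 (G H : groupType) (f : G -> H) : {morph f : x y / x * y} -> f 1 = 1.
Proof. by move=> fM; apply: (mulgI (f 1)); rewrite -fM !mulg1. Qed.

Lemma morphV (G H : groupType) (f : G -> H) : {morph f : x y / x * y} ->
  {morph f : x / x^-1}.
Proof. by move=> fM x; apply: (mulgI (f x)); rewrite -fM !mulgV (morph1 fM). Qed.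

Lemma free_group_ext (A : choiceType) (H : groupType) (f g : free_group A -> H) :
  {morph f : x y / x * y} -> {morph g : x y / x * y} ->
  (forall a, f (fg_gen a) = g (fg_gen a)) -> f =1 g.
Proof.
move=> fM gM fg x; rewrite (fg_lift_unique fM fg).
by rewrite (fg_lift_unique gM (fun=> erefl)).
Qed.

Lemma fg_lift_ind (A : choiceType) (H : groupType) (h : A -> H) (P : H -> Prop) :
  P 1 -> (forall x y, P x -> P y -> P (x * y)) -> (forall x, P x -> P x^-1) ->
  (forall a, P (h a)) -> forall x, P (fg_lift h x).
Proof.
move=> P1 PM PV Ph [w rw]; rewrite /fg_lift /=; elim: w {rw} => //= l w IHw.
by apply: PM => //; rewrite /letter_eval; case: (l.2); [|apply: PV].
Qed.

End Morphisms.

Section QuotientIso.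
Local Open Scope group_scope.
Variables (G H : groupType) (N : normal_subgroup G) (M : normal_subgroup H).

Lemma quotient_iso (phi : G -> H) :
  {morph phi : x y / x * y} -> (forall x, ns_set N x <-> ns_set M (phi x)) ->
  (forall y, exists x, ns_set M ((phi x)^-1 * y)) ->
  isomorphic (quotient_group N) (quotient_group M).
Proof.
move=> phiM phiN phiS.
pose f (a : quotient_group N) := coset_pi M (phi (repr a)).
have fE x : f (coset_pi N x) = coset_pi M (phi x).
  apply/coset_piP; rewrite -(morphV phiM) -phiM; apply/phiN/coset_piP.
  by rewrite coset_reprK.
have /choice[g gP] (b : quotient_group M) : exists a, f a = b.
  have [x xb] := phiS (repr b); exists (coset_pi N x); rewrite fE -[b]coset_reprK.
  exact/coset_piP.
exists f; last first.
  move=> a b; rewrite -(coset_reprK a) -(coset_reprK b) -coset_piM !fE phiM.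
  exact: coset_piM.
exists g => // a; have := gP (f a).
rewrite -(coset_reprK a) -(coset_reprK (g _)) !fE => /coset_piP.
by rewrite -(morphV phiM) -phiM => /phiN/coset_piP ->; rewrite coset_reprK.
Qed.

End QuotientIso.

Section Subdirect.
Local Open Scope group_scope.
Variables (G W : groupType) (wpos : W -> Prop) (I : countType) (h : I -> G -> W).
Hypothesis hM : forall i, {morph h i : x y / x * y}.
Hypothesis wpos1 : ~ wpos 1.
Hypothesis wposM : forall x y, wpos x -> wpos y -> wpos (x * y).
Hypothesis wposJ : forall x y, wpos x -> wpos (x ^ y).
Hypothesis wpos_tot : forall i x, [\/ h i x = 1, wpos (h i x) | wpos (h i x)^-1].

(** Order by the first coordinate, in an enumeration of the indices, that does not
    vanish. *)
Lemma subdirect_cone (D : I -> Prop) :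
  exists P, quotient_cone (fun x => forall i, D i -> h i x = 1) P.
Proof.
pose P x := exists i, [/\ D i, wpos (h i x) &
  forall j, D j -> (pickle j < pickle i)%N -> h j x = 1].
exists P; split.
- by move=> x Nx [i [Di + _]]; rewrite Nx.
- move=> x y [i [Di xi ix]] [j [Dj yj jy]].
  have [ij|ji|ij] := ltngtP (pickle i) (pickle j).
  + exists i; split=> // [|k Dk ki]; first by rewrite hM (jy i) // mulg1.
    by rewrite hM ix // jy ?mulg1 // (ltn_trans ki).
  + exists j; split=> // [|k Dk kj]; first by rewrite hM (ix j) // mul1g.
    by rewrite hM jy // ix ?mulg1 // (ltn_trans kj).
  + have {ij} e := pcan_inj pickleK ij; rewrite -{j}e in Dj yj jy.
    exists i; split=> // [|k Dk ki]; first by rewrite hM; exact: wposM.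
    by rewrite hM ix // jy // mulg1.
- have hJ i x y : h i (x ^ y) = h i x ^ h i y.
    by rewrite /conjg !hM (morphV (hM i)).
  move=> x y [i [Di xi ix]]; exists i; split=> // [|j Dj ji].
    by rewrite hJ; exact: wposJ.
  by rewrite hJ ix // /conjg mul1g mulVg.
- move=> x; have [Nx|] := pselect (forall i, D i -> h i x = 1); first by constructor 1.
  move=> /existsNP[i0 /not_implyP[Di0 hi0]].
  have exb : exists n, `[< exists i, [/\ pickle i = n, D i & h i x <> 1] >].
    by exists (pickle i0); apply/asboolP; exists i0.
  case: (ex_minnP exb) => n /asboolP[i [<- Di hi]] nmin.
  have below j : D j -> (pickle j < pickle i)%N -> h j x = 1.
    move=> Dj ji; apply: contrapT => hj.
    have : pickle i <= pickle j by apply: nmin; apply/asboolP; exists j.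
    by rewrite leqNgt ji.
  have [//|p|p] := wpos_tot i x; first by constructor 2; exists i.
  constructor 3; exists i; split=> // [|j Dj ji]; first by rewrite (morphV (hM i)).
  by rewrite (morphV (hM j)) below // invg1.
Qed.

End Subdirect.

HB.instance Definition _ (A : countType) := [Countable of free_group A by <:].

(** * Orders on wreath products *)

Section Wreath.
Local Open Scope group_scope.
Variables A G : groupType.

(** The unrestricted wreath product: functions from [G] to [A] with [G] acting by
    left translation. *)
Definition wreath : Type := ((G -> A) * G)%type.
HB.instance Definition _ := Choice.copy wreath ((G -> A) * G)%type.

Definition wr_one : wreath := (fun=> 1, 1).
Definition wr_mul (x y : wreath) : wreath :=
  (fun h => x.1 h * y.1 (x.2^-1 * h), x.2 * y.2).
Definition wr_inv (x : wreath) : wreath := (fun h => (x.1 (x.2 * h))^-1, x.2^-1).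

Lemma wr_mulA : associative wr_mul.
Proof.
move=> x y z; rewrite /wr_mul /= mulgA; congr (_, _).
by apply/funext => h; rewrite invgM !mulgA.
Qed.
Lemma wr_mul1 : left_id wr_one wr_mul.
Proof.
move=> [f g]; rewrite /wr_mul /= mul1g; congr (_, _).
by apply/funext => h; rewrite invg1 !mul1g.
Qed.
Lemma wr_mulr1 : right_id wr_one wr_mul.
Proof.
move=> [f g]; rewrite /wr_mul /= mulg1; congr (_, _).
by apply/funext => h; rewrite mulg1.
Qed.
Lemma wr_mulV : left_inverse wr_one wr_inv wr_mul.
Proof.
move=> [f g]; rewrite /wr_mul /= mulVg; congr (_, _).
by apply/funext => h; rewrite invgK mulVg.
Qed.
Lemma wr_mulrV : right_inverse wr_one wr_inv wr_mul.
Proof.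
move=> [f g]; rewrite /wr_mul /= mulgV; congr (_, _).
by apply/funext => h; rewrite mulVKg mulgV.
Qed.

HB.instance Definition _ :=
  isGroup.Build wreath wr_mulA wr_mul1 wr_mulr1 wr_mulV wr_mulrV.

Variables (posA : A -> Prop) (posG : G -> Prop).
Hypothesis coneA : quotient_cone (eq^~ 1) posA.
Hypothesis coneG : quotient_cone (eq^~ 1) posG.

(** The component in [G] decides first, and then the value at the largest point of
    the support. *)
Definition wpos (x : wreath) : Prop :=
  posG x.2 \/ x.2 = 1 /\ exists k, posA (x.1 k) /\
    forall h, posG (k^-1 * h) -> x.1 h = 1.

(** Finite support, which gives a nontrivial element of the base group a largest
    point where it does not vanish. *)
Definition wfin (x : wreath) : Prop :=
  exists s : seq G, forall h, h \notin s -> x.1 h = 1.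

Lemma wfin1 : wfin 1. Proof. by exists [::]. Qed.

Lemma wfinM x y : wfin x -> wfin y -> wfin (x * y).
Proof.
case=> s sP [t tP]; exists (s ++ [seq x.2 * h | h <- t]) => h.
rewrite mem_cat negb_or => /andP[/sP hs ht].
have -> : (x * y).1 h = x.1 h * y.1 (x.2^-1 * h) by [].
rewrite hs tP ?mulg1 //; apply: contra ht => ht.
by apply/mapP; exists (x.2^-1 * h); rewrite ?mulVKg.
Qed.

Lemma wfinV x : wfin x -> wfin x^-1.
Proof.
case=> s sP; exists [seq x.2^-1 * h | h <- s] => h hs.
have -> : (x^-1).1 h = (x.1 (x.2 * h))^-1 by [].
rewrite sP ?invg1 //; apply: contra hs => hs.
by apply/mapP; exists (x.2 * h); rewrite ?mulKg.
Qed.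

Lemma wpos1 : ~ wpos 1.
Proof.
have [/(_ 1 erefl) A1 _ _ _] := coneA; have [/(_ 1 erefl) G1 _ _ _] := coneG.
by case=> [/G1|[_ [k [/A1]]]].
Qed.

Lemma wposM x y : wpos x -> wpos y -> wpos (x * y).
Proof.
have [_ AM _ _] := coneA; have [_ GM _ Gtot] := coneG.
case: x y => [f g] [f' g'] [/= px|/= [-> [k [fk kf]]]] [/= py|/= [-> [k' [fk' kf']]]].
- by left; exact: GM.
- by left; rewrite /= mulg1.
- by left; rewrite /= mul1g.
right; split; first exact: mulg1.
have E h : (((f, 1) : wreath) * ((f', 1) : wreath)).1 h = f h * f' h.
  by rewrite -[LHS]/(f h * f' (1^-1 * h)) invg1 mul1g.
have [kk'|kk'|k'k] := Gtot (k^-1 * k').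
- have {}kk' : k' = k by rewrite -[k'](mulVKg k) kk' mulg1.
  rewrite {}kk' in fk' kf'; exists k; rewrite E; split; first exact: AM.
  by move=> h kh; rewrite E kf // kf' // mulg1.
- exists k'; rewrite E kf // mul1g; split=> // h kh; rewrite E kf' // kf ?mulg1 //.
  by have := GM _ _ kk' kh; rewrite mulgA mulgK.
- rewrite invgM invgK in k'k.
  exists k; rewrite E kf' // mulg1; split=> // h kh; rewrite E kf // kf' ?mulg1 //.
  by have := GM _ _ k'k kh; rewrite mulgA mulgK.
Qed.

(** Conjugation translates the support and conjugates the values, and both orders
    are invariant. *)
Lemma wposJ x y : wpos x -> wpos (x ^ y).
Proof.
have [_ _ AJ _] := coneA; have [_ _ GJ _] := coneG.
case: x y => [f g] [f' g'] [/= px|/= [-> [k [fk kf]]]]; first by left; exact: GJ.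
have E h : (((f, 1) : wreath) ^ ((f', g') : wreath)).1 h = f (g' * h) ^ f' (g' * h).
  rewrite /conjg -[LHS]/((f' (g' * h))^-1 * (f (g'^-1^-1 * h) * f' (1^-1 * (g'^-1^-1 * h)))).
  by rewrite invg1 mul1g invgK.
right; split; first by rewrite -[LHS]/(g'^-1 * (1 * g')) mul1g mulVg.
exists (g'^-1 * k); rewrite E mulVKg; split; first exact: AJ.
move=> h; rewrite invgM invgK -mulgA => /kf fh.
by rewrite E fh /conjg mul1g mulVg.
Qed.

Lemma support_max (f : G -> A) (s : seq G) : (exists2 k, k \in s & f k <> 1) ->
  exists k, [/\ k \in s, f k <> 1 & forall h, h \in s -> f h <> 1 -> ~ posG (k^-1 * h)].
Proof.
have [G1 GM _ _] := coneG.
elim: s => [[k]//|a s IHs] [k0 k0s fk0].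
have nposaa k : ~ posG (k^-1 * k) by rewrite mulVg; exact: G1.
have [|ns] := pselect (exists2 k, k \in s & f k <> 1); last first.
  have only h : h \in a :: s -> f h <> 1 -> h = a.
    by rewrite in_cons => /predU1P[//|hs] fh; case: ns; exists h.
  have e := only _ k0s fk0; rewrite e in fk0.
  by exists a; split=> // [|h hs fh]; [exact: mem_head|rewrite (only h)].
move=> /IHs[k [ks fk kmax]].
have [[fa ka]|na] := pselect (f a <> 1 /\ posG (k^-1 * a)).
  exists a; split=> // [|h]; first exact: mem_head.
  rewrite in_cons => /predU1P[->//|hs] fh ah; apply: (kmax h hs fh).
  by have := GM _ _ ka ah; rewrite mulgA mulgK.
exists k; split=> // [|h]; first by rewrite in_cons ks orbT.
rewrite in_cons => /predU1P[->|hs fh]; last exact: kmax.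
by move=> fa ka; apply: na.
Qed.

Lemma wpos_total x : wfin x -> [\/ x = 1, wpos x | wpos x^-1].
Proof.
have [_ _ _ Atot] := coneA; have [_ _ _ Gtot] := coneG.
case: x => f g [s /= sP].
have [->|pg|pg] := Gtot g; [|by constructor 2; left|by constructor 3; left].
have [f1|/existsNP[k fk]] := pselect (forall h, f h = 1).
  by constructor 1; congr (_, _); apply/funext.
have [|k' [k's fk' kmax]] := @support_max f s.
  by exists k => //; apply: contrapT => ks; apply: fk; apply: sP; apply/negP.
have above h : posG (k'^-1 * h) -> f h = 1.
  move=> kh; apply: contrapT => fh; have [hs|/sP//] := boolP (h \in s).
  exact: kmax fh kh.
have [//|p|p] := Atot (f k'); first by constructor 2; right; split=> //; exists k'.
constructor 3; right; split; first exact: invg1.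
have E h : (((f, 1) : wreath)^-1).1 h = (f h)^-1 by rewrite -[LHS]/((f (1 * h))^-1) mul1g.
by exists k'; rewrite E; split=> // h kh; rewrite E above // invg1.
Qed.

End Wreath.

Local Notation Gamma := (free_group bool).
Local Notation W := (wreath Gamma Gamma).

(** * A family of bi-orderable quotients indexed by subsets of a free group *)

Section Hall.
Local Open Scope group_scope.

Lemma free_pos_cone : quotient_cone (eq^~ 1) free_pos.
Proof.
split; [by move=> x -> /free_pos_neq1|exact: free_posM|exact: free_posJ|exact: free_pos_total].
Qed.

Definition spike (a k : Gamma) : W := (fun h => if h == k then a else 1, 1).

Definition wr_top (g : Gamma) : W := (fun=> 1, g).

Lemma wr_topM : {morph wr_top : x y / x * y}.
Proof. by move=> x y; congr (_, _); apply/funext => h; rewrite /= mulg1. Qed.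

Lemma spikeJ a g : wr_top g * spike a 1 * (wr_top g)^-1 = spike a g.
Proof.
congr (_, _) => /=; last by rewrite mulg1 mulgV.
apply/funext => h; rewrite /= mul1g invg1 mulg1.
have -> // : (g^-1 * h == 1) = (h == g).
by apply/eqP/eqP => [e|->]; [rewrite -[h](mulVKg g) e mulg1|rewrite mulVg].
Qed.

Lemma spikeM a b k l : spike a k * spike b l =
  (fun h => (if h == k then a else 1) * (if h == l then b else 1), 1) :> W.
Proof.
rewrite -[LHS]/((fun h => (spike a k).1 h * (spike b l).1 (1^-1 * h), 1 * 1) : W).
by rewrite mulg1; congr pair; apply/funext => h; rewrite invg1 mul1g.
Qed.

Lemma spike_commute a b k : k <> 1 -> spike a 1 * spike b k = spike b k * spike a 1.
Proof.
move=> k1; rewrite !spikeM; congr (_, _); apply/funext => h.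
have [->|_] := eqVneq h 1; last by rewrite mul1g mulg1.
by have /eqP/negbTE -> := nesym k1; rewrite mul1g mulg1.
Qed.

Let s : Gamma := fg_gen true.
Let t : Gamma := fg_gen false.

Lemma spike_noncommute : spike s 1 * spike t 1 <> spike t 1 * spike s 1.
Proof.
rewrite !spikeM => /(congr1 (fun x : W => x.1 1)).
by rewrite /fst eqxx => /(congr1 (@word_of _)).
Qed.

Definition rho_gen (i : nat) : W :=
  match i with
  | 0 => wr_top s | 1 => wr_top t | 2 => spike s 1 | 3 => spike t 1 | _ => 1
  end.

Definition rho : F_infty -> W := fg_lift rho_gen.

Lemma rhoM : {morph rho : x y / x * y}. Proof. exact: fg_liftM. Qed.

Lemma rho_fin w : wfin (rho w).
Proof.
apply: fg_lift_ind; [exact: wfin1|exact: wfinM|exact: wfinV|].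
have fs a k : wfin (spike a k).
  by exists [:: k] => h; rewrite inE /= => /negbTE ->.
by move=> [|[|[|[|i]]]] //=; try (by exists [::]).
Qed.

Definition iota_gen (b : bool) : F_infty := fg_gen (if b then 0%N else 1%N).
Definition iota_word : Gamma -> F_infty := fg_lift iota_gen.

Lemma iota_wordM : {morph iota_word : x y / x * y}. Proof. exact: fg_liftM. Qed.

Lemma rho_iota_word g : rho (iota_word g) = wr_top g.
Proof.
apply: (free_group_ext (f := rho \o iota_word)).
- by move=> x y /=; rewrite iota_wordM rhoM.
- exact: wr_topM.
by case; rewrite /= /iota_word fg_lift_gen /rho fg_lift_gen.
Qed.

Definition theta_gen (d : Gamma) (i : nat) : F_infty :=
  if i == 3%N then iota_word d * fg_gen 3%N * (iota_word d)^-1 else fg_gen i.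

Definition theta (d : Gamma) : F_infty -> F_infty := fg_lift (theta_gen d).

Lemma thetaM d : {morph theta d : x y / x * y}. Proof. exact: fg_liftM. Qed.

Lemma theta_iota_word d g : theta d (iota_word g) = iota_word g.
Proof.
apply: (free_group_ext (f := theta d \o iota_word)) g.
- by move=> x y /=; rewrite iota_wordM thetaM.
- exact: iota_wordM.
by case; rewrite /= /iota_word fg_lift_gen /theta fg_lift_gen.
Qed.

(** The automorphisms fix the copy of [Gamma] that they conjugate by, so composing
    them multiplies the conjugators in the opposite order. *)
Lemma theta_comp d e w : theta d (theta e w) = theta (e * d) w.
Proof.
apply: (free_group_ext (f := theta d \o theta e)) w.
- by move=> x y /=; rewrite !thetaM.
- exact: thetaM.
move=> i; rewrite /= {2 3}/theta !fg_lift_gen /theta_gen; case: eqP => [_|ni].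
  rewrite !thetaM (morphV (@thetaM d)) !theta_iota_word /theta fg_lift_gen /theta_gen /=.
  by rewrite iota_wordM invgM !mulgA.
by rewrite /theta fg_lift_gen /theta_gen; case: eqP.
Qed.

Lemma theta1 w : theta 1 w = w.
Proof.
apply: (free_group_ext (g := id)) w => //; first exact: thetaM.
move=> i; rewrite /theta fg_lift_gen /theta_gen; case: eqP => // ->.
by rewrite (morph1 iota_wordM) invg1 mul1g mulg1.
Qed.

(** The commutator of the two generators that [rho] sends to the base group. *)
Definition test_word : F_infty :=
  (fg_gen 2%N * fg_gen 3%N) * (fg_gen 3%N * fg_gen 2%N)^-1.

(** The two spikes sit at [1] and at [d], so they commute exactly when these
    coordinates differ. *)
Lemma rho_theta_test_word d : rho (theta d test_word) = 1 <-> d <> 1.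
Proof.
have r2 : rho (theta d (fg_gen 2%N)) = spike s 1.
  by rewrite /theta fg_lift_gen /rho fg_lift_gen.
have r3 : rho (theta d (fg_gen 3%N)) = spike t d.
  rewrite /theta fg_lift_gen /theta_gen /= !rhoM (morphV rhoM) rho_iota_word.
  by rewrite /rho fg_lift_gen spikeJ.
have [rt [rtM rtE]] : exists rt : F_infty -> W, {morph rt : x y / x * y} /\
    forall w, rho (theta d w) = rt w.
  by exists (rho \o theta d); split=> // x y /=; rewrite thetaM rhoM.
rewrite !rtE in r2 r3 *; rewrite /test_word rtM (morphV rtM) !rtM r2 r3.
split=> [e d1|d1]; last by rewrite spike_commute // mulgV.
apply: spike_noncommute; rewrite d1 in e.
by rewrite -[LHS](mulgVK (spike t 1 * spike s 1)) e mul1g.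
Qed.

(** An element [k] lies outside of [D] exactly when, in the quotient, the third
    generator commutes with the conjugate of the fourth one by the inverse of [k]
    ([hall_mem]). *)
Definition hall (D : Gamma -> Prop) : set F_infty :=
  [set w | forall d, D d -> rho (theta d w) = 1].

Lemma hall_normal D : is_normal_subgroup (hall D).
Proof.
have rtM d x y : rho (theta d (x * y)) = rho (theta d x) * rho (theta d y).
  by rewrite thetaM rhoM.
have rtV d x : rho (theta d x^-1) = (rho (theta d x))^-1.
  by rewrite (morphV (@thetaM d)) (morphV rhoM).
split.
- by move=> d _; rewrite (morph1 (@thetaM d)) (morph1 rhoM).
- by move=> x y Nx Ny d Dd; rewrite rtM Nx // Ny // mulg1.
- by move=> x Nx d Dd; rewrite rtV Nx // invg1.
- by move=> x y Nx d Dd; rewrite /conjg !rtM rtV Nx // mul1g mulVg.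
Qed.

Lemma hall_gen D i : (3 < i)%N -> hall D (fg_gen i).
Proof.
case: i => [|[|[|[|i]]]] // _ d _.
by rewrite /theta fg_lift_gen /rho fg_lift_gen.
Qed.

(** The maps [rho \o theta d] embed the quotient in a power of the wreath product,
    with images of finite support. *)
Lemma hall_bi_orderable D (nD : is_normal_subgroup (hall D)) :
  bi_orderable (quotient_group (NormalSubgroup nD)).
Proof.
have c := free_pos_cone.
have [|||||P] := @subdirect_cone F_infty W (wpos free_pos free_pos) Gamma
  (fun d => rho \o theta d) _ _ _ _ _ D.
- by move=> d x y /=; rewrite thetaM rhoM.
- exact: wpos1.
- exact: wposM.
- exact: wposJ.
- by move=> d x; apply: wpos_total => //; exact: rho_fin.
exact: (@cone_bi_orderable _ (NormalSubgroup nD) P).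
Qed.

(** Moving the test word by the inverse of [theta k] makes it survive at the
    index [k] only. *)
Lemma hall_mem D k : D k <-> ~ hall D (theta k^-1 test_word).
Proof.
have E d : rho (theta d (theta k^-1 test_word)) = 1 <-> d <> k.
  rewrite theta_comp rho_theta_test_word; split=> + dk; apply.
    by rewrite dk mulVg.
  by rewrite -[d](mulVKg k) dk mulg1.
split=> [Dk /(_ k Dk)/E//|nD].
by apply: contrapT => nDk; apply: nD => d Dd; apply/E => dk; apply: nDk; rewrite -dk.
Qed.

Lemma hall_translate D D' g w : (forall d, D' d <-> D (g^-1 * d)) ->
  hall D' w <-> hall D (theta g w).
Proof.
move=> DD'; split=> Hw d Dd.
  by rewrite theta_comp; apply: Hw; apply/DD'; rewrite mulKg.
by have := Hw (g^-1 * d) ((DD' d).1 Dd); rewrite theta_comp mulVKg.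
Qed.

End Hall.

(** * Polish spaces from sequences of integer-valued coordinates *)

Section CodedDef.
Local Open Scope classical_set_scope.
Local Open Scope ring_scope.

Variables (R : realType) (T : pointedType) (c : nat -> T -> nat).

(** The sequences of codes form a closed subset of the Baire space. *)
Definition complete_code : Prop := forall v : nat -> nat,
  (forall k, exists x, forall n, (n < k)%N -> c n x = v n) ->
  exists x, forall n, c n x = v n.

(** The open sets of the topology that the coordinates induce. *)
Definition code_open (A : set T) : Prop := forall x, A x ->
  exists k, forall y, (forall n, (n < k)%N -> c n x = c n y) -> A y.

(** The proof of completeness is a parameter so that the complete pseudometric
    structure can be attached to this alias of [T]. *)
Definition coded_space (cc : complete_code) : Type := T.

Variable cc : complete_code.
Local Notation CT := (coded_space cc).
HB.instance Definition _ := Pointed.on CT.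

(** The ultrametric in which two points that first differ at coordinate [n] have
    distance [1 / (n + 1)]; radii must be positive for the triangle inequality. *)
Definition code_ball (x : CT) (e : R) (y : CT) : Prop :=
  0 < e /\ forall n, e <= n.+1%:R^-1 -> c n x = c n y.

HB.instance Definition _ := hasNbhs.Build CT (nbhs_ball_ code_ball).

Lemma code_nbhsE : @nbhs CT CT = nbhs_ (entourage_ code_ball).
Proof.
rewrite predeq2E => x A; split.
  move=> [e /= e0 sA]; exists [set xy | code_ball xy.1 e xy.2]; first by exists e.
  by move=> y /xsectionP; exact: sA.
by move=> [E [e /= e0 sE] sA]; exists e => // y xy; apply/sA/xsectionP/sE.
Qed.

Lemma code_ball_center x (e : R) : 0 < e -> code_ball x e x.
Proof. by []. Qed.

Lemma code_ball_sym x y (e : R) : code_ball x e y -> code_ball y e x.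
Proof. by case=> e0 xy; split=> // n /xy. Qed.

Lemma code_ball_triangle x y z (e1 e2 : R) :
  code_ball x e1 y -> code_ball y e2 z -> code_ball x (e1 + e2) z.
Proof.
case=> e10 xy [e20 yz]; split=> [|n ne]; first exact: addr_gt0.
rewrite xy ?yz //; apply: le_trans ne; first by rewrite lerDr ltW.
by rewrite lerDl ltW.
Qed.

HB.instance Definition _ := Nbhs_isPseudoMetric.Build R CT code_nbhsE
  code_ball_center code_ball_sym code_ball_triangle erefl.

Lemma code_ball_agree (x y : CT) k : ball x (k.+1%:R^-1 : R) y ->
  forall n, (n <= k)%N -> c n x = c n y.
Proof.
move=> [_ xy] n nk; apply: xy; rewrite lef_pV2 ?posrE ?ltr0n //.
by rewrite ler_nat.
Qed.

Lemma agree_code_ball (x : CT) (e : R) : 0 < e -> exists k, forall y : CT,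
  (forall n, (n < k)%N -> c n x = c n y) -> ball x e y.
Proof.
move=> e0; have [k _ kP] := near_infty_natSinv_lt (PosNum e0).
exists k => y xy; split=> // n en; apply: xy; rewrite ltnNge; apply/negP => kn.
by have := kP n kn; rewrite /= ltNge en.
Qed.

Lemma code_openP (A : set CT) : open A <-> code_open A.
Proof.
rewrite openE; split=> AA x Ax.
  have /nbhs_ballP[e /= e0 sA] := AA x Ax.
  by have [k kP] := agree_code_ball x e0; exists k => y xy; apply/sA/kP.
have [k kP] := AA x Ax; apply/nbhs_ballP; exists (k.+1%:R^-1) => //=.
by move=> y xy; apply: kP => n nk; apply: (code_ball_agree xy); exact: ltnW.
Qed.

Lemma coded_complete (F : set_system CT) : ProperFilter F -> cauchy F -> cvg F.
Proof.
move=> FF cF; have {cF} /cauchyP cF : cauchy F := cF.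
have /choice[z zP] k : exists x : CT, F (ball x (k.+1%:R^-1 : R)) by exact: cF.
have meet k l n : (n <= k)%N -> (n <= l)%N -> c n (z k) = c n (z l).
  move=> nk nl; have [y [ky ly]] := filter_ex (filterI (zP k) (zP l)).
  by rewrite (code_ball_agree ky nk) (code_ball_agree ly nl).
have [x xP] : exists x, forall n, c n x = c n (z n).
  apply: cc => k; exists (z k) => n /ltnW nk; exact: meet.
apply/cvg_ex; exists x => A /nbhs_ballP[e /= e0 sA].
have [k kP] := agree_code_ball x e0; apply: filterS (zP k) => y zy.
apply/sA/kP => n nk; rewrite xP -(code_ball_agree zy (ltnW nk)).
by apply: meet => //; exact: ltnW.
Qed.

HB.instance Definition _ := Uniform_isComplete.Build CT coded_complete.

Lemma coded_polish : (forall x y, (forall n, c n x = c n y) -> x = y) ->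
  polish (CT : completePseudoMetricType R).
Proof.
move=> sep; split.
  rewrite ball_hausdorff => x y /eqP xy.
  have [n cn] : exists n, c n x <> c n y.
    apply: contrapT => ne; apply: xy; apply: sep => n; apply: contrapT => nn.
    by apply: ne; exists n.
  have p : 0 < (n.+1%:R^-1 : R) by rewrite invr_gt0.
  exists (PosNum p, PosNum p); apply/eqP; rewrite -subset0 => w /= [xw yw].
  by apply: cn; rewrite (code_ball_agree xw (leqnn n)) (code_ball_agree yw (leqnn n)).
pose fits (s : seq nat) (x : CT) := forall n, (n < size s)%N -> c n x = nth 0%N s n.
have /choice[w wP] s : exists x, (exists y, fits s y) -> fits s x.
  by have [[y sy]|ns] := pselect (exists y, fits s y); [exists y|exists point].
exists (range w).
  by apply: (sub_countable (card_image_le _ _)); exact: countableP.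
move=> O [x Ox] /code_openP/(_ x Ox)[k kP].
pose s := mkseq (c^~ x) k; exists (w s); split; last by exists s.
apply: kP => n nk; have fx : fits s x.
  by move=> i; rewrite size_mkseq => ik; rewrite nth_mkseq.
by rewrite fx ?size_mkseq // wP ?size_mkseq //; exists x.
Qed.

End CodedDef.

Section CodedStandard.
Local Open Scope classical_set_scope.
Variables (R : realType) (d : measure_display) (X : measurableType d).
Variable c : nat -> X -> nat.

(** The coordinates induce a Polish topology, whose open sets are countable unions
    of sets that prescribe finitely many coordinates and hence measurable. *)
Theorem coded_standard_borel : complete_code c ->
  (forall x y, (forall n, c n x = c n y) -> x = y) ->
  (forall n m, measurable [set x | c n x = m]) ->
  (forall A : set X, measurable A -> <<s code_open c >> A) ->
  standard_borel R X.
Proof.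
move=> cc sep mc gen; pose P : completePseudoMetricType R := coded_space cc.
have openE : @open P = code_open c.
  by apply/funext => A; apply/propext; exact: code_openP.
exists P; first exact: coded_polish.
exists id, id; split=> //; last first.
  by move=> _ A mA; rewrite setTI /= /measurable /= openE; exact: gen.
apply: (@measurability _ _ _ _ setT (id : X -> borel_space P) (@open P)) => //.
move=> _ [A oA <-]; rewrite setTI.
have {}oA : code_open c A by rewrite -openE.
rewrite (_ : _ @^-1` _ = [set x | exists s : seq nat,
   (forall n, (n < size s)%N -> c n x = nth 0%N s n) /\
   forall y, (forall n, (n < size s)%N -> c n y = nth 0%N s n) -> A y]).
  apply: meas_ex => s; apply: meas_and; last exact: meas_prop.
  by apply: meas_all => n; apply: meas_imp; [exact: meas_prop|exact: mc].
apply/seteqP; split=> x /=; last by case=> s [sx]; apply.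
move=> /oA[k kP]; exists (mkseq (c^~ x) k); split=> [n|y].
  by rewrite size_mkseq => nk; rewrite nth_mkseq.
rewrite size_mkseq => sy; apply: kP => n nk.
by rewrite sy // nth_mkseq.
Qed.

End CodedStandard.

(** * The space of finitely generated bi-orderable groups *)

Section BOStandard.
Local Open Scope classical_set_scope.
Local Open Scope group_scope.

Definition mem_BO (N : BO_elt) (g : F_infty) : Prop := (BO_val N : set F_infty) g.

Lemma BO_eq (N M : BO_elt) : (forall g, mem_BO N g <-> mem_BO M g) -> N = M.
Proof.
move=> NM; apply: val_inj; apply/funext => g; apply/propext; exact: NM.
Qed.

Lemma BO_build (N : set F_infty) : is_normal_subgroup N ->
  (exists n, forall i, (n <= i)%N -> N (fg_gen i)) ->
  (exists P, quotient_cone N P) -> exists M : BO_elt, mem_BO M = N.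
Proof.
move=> nN [n Nn] [P cP].
have BN : BO N.
  split; last by exists nN; exact: (cone_bi_orderable (N := NormalSubgroup nN) cP).
  split=> //; apply: (sub_finite_set _ (finite_II n)) => i /= Ni.
  by rewrite ltnNge; apply/negP => /Nn.
by exists (SigSub (mem_set BN) : BO_elt).
Qed.

Lemma BO_cone (N : BO_elt) : exists P, quotient_cone (mem_BO N) P.
Proof.
have [_ [nN bN]] : BO (val N) by exact: set_valP.
exact: bi_orderable_cone bN.
Qed.

Lemma BO_bound (N : BO_elt) : exists n,
  (forall i, (n <= i)%N -> mem_BO N (fg_gen i)) /\
  forall m, (forall i, (m <= i)%N -> mem_BO N (fg_gen i)) -> (n <= m)%N.
Proof.
have [[_ fN] _] : BO (val N) by exact: set_valP.
have [s sE] := (finite_seqP _).1 fN.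
have ex : exists n, `[< forall i, (n <= i)%N -> mem_BO N (fg_gen i) >].
  exists (\max_(j <- s) j).+1; apply/asboolP => i lti; apply: contrapT => nNi.
  have : [set` s] i by rewrite -sE.
  move=> /= si; have := leq_bigmax_seq (P := xpredT) (F := id) i si isT.
  by rewrite leqNgt lti.
case: (ex_minnP ex) => n /asboolP Nn nmin; exists n; split=> // m Nm.
by apply: nmin; apply/asboolP.
Qed.

Definition gen_bound (N : BO_elt) : nat := projT1 (cid (BO_bound N)).

Lemma gen_boundP N i : (gen_bound N <= i)%N -> mem_BO N (fg_gen i).
Proof. by have [Nn _] := projT2 (cid (BO_bound N)); exact: Nn. Qed.

Lemma gen_bound_min N m : (forall i, (m <= i)%N -> mem_BO N (fg_gen i)) ->
  (gen_bound N <= m)%N.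
Proof. by have [_ nmin] := projT2 (cid (BO_bound N)); exact: nmin. Qed.

(** The first coordinate bounds the generators outside of [N]. Without it a limit
    of normal subgroups could omit infinitely many generators. *)
Definition BO_code (n : nat) (N : BO_space) : nat :=
  if n is k.+1 then
    (if (unpickle k : option F_infty) is Some g
     then nat_of_bool `[< mem_BO N g >] else 0%N)
  else gen_bound N.

Lemma BO_code_mem N M (g : F_infty) :
  BO_code (pickle g).+1 N = BO_code (pickle g).+1 M -> mem_BO N g <-> mem_BO M g.
Proof.
rewrite /BO_code pickleK => e; apply: asbool_eq_equiv.
by move: e; case: asboolP; case: asboolP.
Qed.

(** Normality and the bound on the generators involve finitely many elements at a
    time, so they pass to the limit. The limit of the positive cones along a free
    ultrafilter is a positive cone for the limit. *)
Lemma BO_complete : complete_code BO_code.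
Proof.
move=> v /choice[N NP].
pose M : set F_infty := [set g | v (pickle g).+1 = 1%N].
have NM g : exists k, forall j, (k <= j)%N -> mem_BO (N j) g <-> M g.
  exists (pickle g).+2 => j gj; have := NP j _ gj.
  by rewrite /M /BO_code /= pickleK => <-; case: asboolP.
have nN j : is_normal_subgroup (mem_BO (N j)) by exact: BO_normal.
have nM : is_normal_subgroup M.
  split.
  - by have [k kP] := NM 1; apply/(kP k) => //; case: (nN k).
  - move=> x y; have [k1 P1] := NM x; have [k2 P2] := NM y; have [k3 P3] := NM (x * y).
    pose j := maxn k1 (maxn k2 k3).
    have [l1 l2 l3] : [/\ (k1 <= j)%N, (k2 <= j)%N & (k3 <= j)%N].
      by rewrite !leq_max !leqnn !orbT.
    move=> /(P1 _ l1) Nx /(P2 _ l2) Ny; apply/(P3 _ l3).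
    by case: (nN j) => _ + _ _; apply.
  - move=> x; have [k1 P1] := NM x; have [k2 P2] := NM x^-1.
    move=> /(P1 (maxn k1 k2) (leq_maxl _ _)) Nx; apply/(P2 _ (leq_maxr k1 k2)).
    by case: (nN (maxn k1 k2)) => _ _ + _; apply.
  - move=> x y; have [k1 P1] := NM x; have [k2 P2] := NM (x ^ y).
    move=> /(P1 (maxn k1 k2) (leq_maxl _ _)) Nx; apply/(P2 _ (leq_maxr k1 k2)).
    by case: (nN (maxn k1 k2)) => _ _ _ +; apply.
have bN j : (0 < j)%N -> gen_bound (N j) = v 0%N by exact: NP.
have Mgen i : (v 0%N <= i)%N -> M (fg_gen i).
  move=> vi; have [k kP] := NM (fg_gen i).
  apply/(kP k.+1 (leqnSn k)); apply: gen_boundP; by rewrite bN.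
have /choice[Q QP] j := BO_cone (N j).
have [U [UU subU]] := @ultraFilterLemma nat eventually _.
have Uev (A : set nat) k : (forall j, (k <= j)%N -> A j) -> U A.
  by move=> kA; apply: subU; exists k.
have [M' M'E] : exists M' : BO_elt, mem_BO M' = M.
  apply: BO_build => //; first by exists (v 0%N).
  exists (fun x => U [set j | Q j x]); split.
  - move=> x Mx Ux; have [k kP] := NM x.
    have Ux' : U [set j | mem_BO (N j) x] by apply: (Uev _ k) => j kj; apply/kP.
    have [j [Nx Qx]] := filter_ex (filterI Ux' Ux).
    by have [/(_ x Nx)] := QP j.
  - move=> x y Ux Uy; apply: filterS2 Ux Uy => j Qx Qy.
    by have [_ + _ _] := QP j; apply.
  - by move=> x y Ux; apply: filterS Ux => j Qx; have [_ _ + _] := QP j; apply.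
  - move=> x; have [Mx|nMx] := pselect (M x); first by constructor 1.
    have [Ux|Ux] := in_ultra_setVsetC [set j | Q j x] UU; first by constructor 2.
    constructor 3; have [k kP] := NM x.
    have Ux' : U [set j | ~ mem_BO (N j) x] by apply: (Uev _ k) => j kj /(kP j kj)/nMx.
    by apply: filterS2 Ux Ux' => j nQ nN'; have [_ _ _ /(_ x)[]] := QP j.
exists M' => -[|k] /=.
  apply/eqP; rewrite eqn_leq gen_bound_min ?M'E //= leqNgt; apply/negP => lt0.
  move: lt0; case vE: (v 0%N) => [//|u]; rewrite ltnS => lu.
  have Mu : M (fg_gen u) by rewrite -M'E; exact: gen_boundP.
  have [k kP] := NM (fg_gen u).
  have : (gen_bound (N k.+1) <= u)%N.
    apply: gen_bound_min => i; rewrite leq_eqVlt => /predU1P[<-|ui].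
      by apply/(kP k.+1 (leqnSn k)).
    by apply: gen_boundP; rewrite bN // vE.
  by rewrite bN // vE ltnn.
rewrite M'E; case Ek: (unpickle k : option F_infty) => [g|]; last first.
  by rewrite -(NP k.+2 k.+1 (ltnSn _)) /BO_code Ek.
(* Several coordinates can decode to [g], so both are read off one
   approximation. *)
pose j := (maxn k.+1 (pickle g).+1).+1.
have := NP j k.+1; rewrite ltnS leq_maxl /BO_code Ek => /(_ isT) <-.
have := NP j (pickle g).+1; rewrite ltnS leq_maxr /BO_code pickleK => /(_ isT).
by rewrite /M /= => <-; do 2 case: asboolP.
Qed.

Lemma open_mem_pow_F (g : F_infty) : open [set S : pow_F | S g].
Proof.
exists [set [set S : pow_F | S g]]; last by rewrite bigcup_set1.
move=> _ ->; exists (finmap.fset1 (g, true)); first by move=> i _; exact: mem_set.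
apply/seteqP; split=> S; last first.
  by move=> Sg i; rewrite /= finmap.in_fset1 => /eqP ->.
by move=> /(_ (g, true)); apply; rewrite /= finmap.in_fset1.
Qed.

Lemma meas_mem_BO g : measurable [set N : BO_space | mem_BO N g].
Proof.
exists ([set S : pow_F | S g] : set (borel_space pow_F)); last by rewrite setTI.
by apply: sub_sigma_algebra; exact: open_mem_pow_F.
Qed.

Lemma meas_BO_code n m : measurable [set N | BO_code n N = m].
Proof.
case: n => [|n].
  pose bnd k := [set N : BO_space | forall i, (k <= i)%N -> mem_BO N (fg_gen i)].
  have mbnd k : measurable (bnd k).
    by apply: meas_all => i; apply: meas_imp; [exact: meas_prop|exact: meas_mem_BO].
  rewrite (_ : [set N | _] = [set N | bnd m N /\ forall k, (k < m)%N -> ~ bnd k N]).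
    apply: meas_and; first exact: mbnd.
    apply: meas_all => k; apply: meas_imp; first exact: meas_prop.
    exact: (meas_not (A := bnd k) (mbnd k)).
  apply/seteqP; split=> N /=.
    move=> <-; split=> [i|k lt]; first exact: gen_boundP.
    by move=> /gen_bound_min; rewrite leqNgt lt.
  case=> bm nb; apply/eqP; rewrite eqn_leq gen_bound_min // leqNgt; apply/negP.
  by move=> /nb; apply=> i; exact: gen_boundP.
rewrite /BO_code; case: unpickle => [g|]; last exact: meas_prop.
rewrite (_ : [set N | _] = [set N : BO_space |
    (mem_BO N g /\ m = 1%N) \/ (~ mem_BO N g /\ m = 0%N)]).
  have mg := meas_mem_BO g.
  apply: meas_or; apply: meas_and => //; try exact: meas_prop.
  exact: meas_not.
apply/seteqP; split=> N /=.
  by move=> <-; case: asboolP => Ng; [left|right].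
by case=> -[Ng ->]; case: asboolP.
Qed.

Lemma BO_code_inj (N M : BO_space) : (forall n, BO_code n N = BO_code n M) -> N = M.
Proof. by move=> NM; apply: BO_eq => g; apply: BO_code_mem. Qed.

(** Open sets of the power set are neighbourhoods of their points because of
    finitely many membership conditions. *)
Lemma open_pow_F (U : set pow_F) (S : pow_F) : open U -> U S ->
  exists l : seq (F_infty * bool), (forall i, i \in l -> pow_F_subbase i S) /\
    forall S' : pow_F, (forall i, i \in l -> pow_F_subbase i S') -> U S'.
Proof.
move=> [D' sD <-] [V D'V VS].
have [F _ FV] : finI_from setT pow_F_subbase V := sD _ D'V.
exists (finmap.enum_fset F); split=> [i iF|S' S'F].
  by move: VS; rewrite -FV; apply.
by exists V => //; rewrite -FV.
Qed.

Lemma BO_code_gen (A : set BO_space) : measurable A -> <<s code_open BO_code >> A.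
Proof.
case=> B mB <-; move: B mB.
apply: smallest_sub.
  by apply: sigma_algebra_image; exact: smallest_sigma_algebra.
move=> U oU; apply: sub_sigma_algebra => N [_ UN].
have [l [lN lU]] := open_pow_F oU UN.
exists (\max_(i <- l) (pickle i.1).+2) => M NM; split=> //; apply: lU => i il.
have /NM/BO_code_mem[NMi MNi] : ((pickle i.1).+1 < \max_(i <- l) (pickle i.1).+2)%N.
  exact: (leq_bigmax_seq (P := xpredT)
    (F := fun i : F_infty * bool => (pickle i.1).+2) i il isT).
have := lN i il; rewrite /pow_F_subbase /=; case: ifP => _; first exact: NMi.
by move=> nNi /MNi.
Qed.

Theorem BO_standard_borel (R : realType) : standard_borel R BO_space.
Proof.
apply: (@coded_standard_borel R _ BO_space BO_code).
- exact: BO_complete.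
- exact: BO_code_inj.
- exact: meas_BO_code.
- exact: BO_code_gen.
Qed.

End BOStandard.

(** * Isomorphism as a countable Borel relation *)

Section Isomorphism.
Local Open Scope classical_set_scope.
Local Open Scope group_scope.

Lemma isomorphic_equivalence : Equivalence isomorphic.
Proof.
split.
- by move=> G; exists id => //; exists id.
- move=> G H [f [g fg gf] fM]; exists g; first by exists f.
  by move=> x y; apply: (can_inj fg); rewrite gf fM !gf.
- move=> G H K [f bf fM] [g bg gM]; exists (g \o f); first exact: bij_comp.
  by move=> x y /=; rewrite fM gM.
Qed.

Definition seq_hom (s : seq F_infty) : F_infty -> F_infty :=
  fg_lift (fun i => nth 1 s i).

Lemma seq_homM s : {morph seq_hom s : x y / x * y}.
Proof. exact: fg_liftM. Qed.

Definition induces_iso (N M : BO_space) (s : seq F_infty) : Prop :=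
  (forall w, mem_BO N w <-> mem_BO M (seq_hom s w)) /\
  forall w, exists v, mem_BO M ((seq_hom s v)^-1 * w).

(** Choose representatives for the images of the finitely many generators that are
    not yet known to lie in [N]. *)
Lemma BO_isoP (N M : BO_space) : BO_iso N M <-> exists s, induces_iso N M s.
Proof.
split=> [[f [g fg gf] fM]|[s [sN sS]]]; last first.
  by apply: (quotient_iso (phi := seq_hom s)) => //; exact: seq_homM.
pose piN := coset_pi (NormalSubgroup (BO_normal N)).
pose piM := coset_pi (NormalSubgroup (BO_normal M)).
pose s := mkseq (fun i => repr (f (piN (fg_gen i)))) (gen_bound N).
have sE w : piM (seq_hom s w) = f (piN w).
  apply: (free_group_ext (f := piM \o seq_hom s) (g := f \o piN)).
  - by move=> x y /=; rewrite seq_homM; exact: coset_piM.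
  - by move=> x y /=; rewrite -fM; congr f; exact: coset_piM.
  move=> i; rewrite /= /seq_hom fg_lift_gen; have [ltin|lein] := ltnP i (gen_bound N).
    by rewrite nth_mkseq //; exact: coset_reprK.
  rewrite nth_default ?size_mkseq //.
  have -> : piN (fg_gen i) = 1.
    by apply/esym/coset_piP; rewrite invg1 mul1g; exact: gen_boundP.
  by rewrite (morph1 fM).
exists s; split=> w.
  have iN x : mem_BO N x <-> piN x = 1.
    split=> [Nx|]; first by apply/esym/coset_piP; rewrite invg1 mul1g.
    by move=> /esym/coset_piP; rewrite invg1 mul1g.
  have iM x : mem_BO M x <-> piM x = 1.
    split=> [Mx|]; first by apply/esym/coset_piP; rewrite invg1 mul1g.
    by move=> /esym/coset_piP; rewrite invg1 mul1g.
  rewrite iN iM sE; split=> [->|e]; first by rewrite (morph1 fM).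
  by apply: (can_inj fg); rewrite e (morph1 fM).
exists (repr (g (piM w))); apply/(coset_piP (NormalSubgroup (BO_normal M))).
rewrite -/(piM _) sE.
by rewrite /piN coset_reprK gf.
Qed.

Lemma meas_BO_iso : measurable [set p : BO_space * BO_space | BO_iso p.1 p.2].
Proof.
rewrite (_ : [set p | _] = [set p | exists s, induces_iso p.1 p.2 s]); last first.
  by apply/seteqP; split=> p /= /BO_isoP.
have m1 w : measurable [set p : BO_space * BO_space | mem_BO p.1 w].
  exact: (meas_pre (T := BO_space) (A := mem_BO^~ w) measurable_fst (meas_mem_BO w)).
have m2 w : measurable [set p : BO_space * BO_space | mem_BO p.2 w].
  exact: (meas_pre (T := BO_space) (A := mem_BO^~ w) measurable_snd (meas_mem_BO w)).
apply: meas_ex => s; apply: meas_and.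
  by apply: meas_all => w; apply: meas_iff.
by apply: meas_all => w; apply: meas_ex => v.
Qed.

(** A group [M] isomorphic to [N] is the preimage of [N] under one of the
    countably many endomorphisms given by finite sequences. *)
Lemma countable_BO_iso (N : BO_space) : countable [set M | BO_iso N M].
Proof.
have /choice[K KP] (s : seq F_infty) : exists M : BO_space,
    (exists M', forall w, mem_BO M' w <-> mem_BO N (seq_hom s w)) ->
    forall w, mem_BO M w <-> mem_BO N (seq_hom s w).
  have [[M MP]|ne] := pselect
    (exists M', forall w, mem_BO M' w <-> mem_BO N (seq_hom s w)).
    by exists M.
  by exists N.
apply: (@sub_countable _ _ _ (range K)); last first.
  by apply: (sub_countable (card_image_le _ _)); exact: countableP.
apply: subset_card_le => M /(@Equivalence_Symmetric _ _ isomorphic_equivalence).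
move=> /BO_isoP[s [sM _]]; exists s => //; apply: BO_eq => w.
by rewrite sM; apply: KP; exists M.
Qed.

Theorem BO_iso_countable_borel (R : realType) :
  countable_borel_equivalence R (BO_iso : BO_space -> BO_space -> Prop).
Proof.
split; [exact: BO_standard_borel| |exact: meas_BO_iso|exact: countable_BO_iso].
have [r s t] := isomorphic_equivalence.
by split=> [N|N M|N M K]; [exact: r|exact: s|exact: t].
Qed.

Lemma meas_fun_BO d (T : measurableType d) (f : T -> BO_space) :
  (forall g, measurable [set x | mem_BO (f x) g]) -> measurable_fun setT f.
Proof.
move=> mf; suff mBf : measurable_fun setT (BO_val \o f : T -> borel_space pow_F).
  move=> _ A [B mB <-]; rewrite !setTI -comp_preimage -[X in measurable X]setTI.
  exact: mBf.
apply: (@measurability _ _ _ _ setT (BO_val \o f : T -> borel_space pow_F)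
  (@open pow_F)) => //.
move=> _ [U oU <-]; rewrite setTI (_ : _ @^-1` _ =
  [set x | exists l : seq (F_infty * bool),
     (forall S : pow_F, (forall i, i \in l -> pow_F_subbase i S) -> U S) /\
     forall i, i \in l -> pow_F_subbase i (BO_val (f x))]).
  apply: meas_ex => l; apply: meas_and; first exact: meas_prop.
  apply: meas_all => -[g b]; apply: meas_imp; first exact: meas_prop.
  by rewrite /pow_F_subbase /=; case: b; [exact: mf|exact: (meas_not (mf g))].
apply/seteqP; split=> x /=; last by case=> l [lU] /lU.
by move=> /(open_pow_F oU)[l [lx lU]]; exists l.
Qed.

End Isomorphism.

(** * Weak universality *)

Section Universality.
Local Open Scope classical_set_scope.
Local Open Scope group_scope.

Variables (d : measure_display) (X : measurableType d).
Variables (e : X -> baire) (g : nat -> X -> X).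
Hypothesis me : measurable_fun setT e.
Hypothesis e_inj : injective e.
Hypothesis mg : forall k, measurable_fun setT (g k).
Hypothesis gK : forall k, involutive (g k).

(** The action of a letter: the first generator shifts the level, and the second
    one applies on level [n] the involution [g n], for which the exponent of the
    letter does not matter. *)
Definition step (l : letter bool) (p : X * int) : X * int :=
  if l.1 then (p.1, (p.2 + (if l.2 then 1 else -1))%R)
  else (if p.2 is Posz n then g n p.1 else p.1, p.2).

Lemma stepK l p : step l (step (letter_inv l) p) = p.
Proof.
case: l p => [[] b] [x k]; rewrite /step /=.
  by rewrite -GRing.addrA; case: b; rewrite /= ?GRing.addNr ?GRing.addrN GRing.addr0.
by case: k => // n; rewrite gK.
Qed.

Definition act (c : Gamma) (p : X * int) : X * int := foldr step p (word_of c).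

Lemma actM a b p : act (a * b) p = act a (act b p).
Proof. by apply: foldr_act_word => l x; exact: stepK. Qed.

Lemma act1 p : act 1 p = p. Proof. by []. Qed.

Lemma actVK a p : act a^-1 (act a p) = p.
Proof. by rewrite -actM mulVg act1. Qed.

Let s : Gamma := fg_gen true.
Let t : Gamma := fg_gen false.

Lemma act_shift n x : act (s ^+ n) (x, 0%R) = (x, Posz n).
Proof.
elim: n => // n IHn; rewrite expgS actM IHn /act /= /step /=.
by rewrite GRing.addrC -intS.
Qed.

(** Climb to level [n], apply [g n], and climb down again. *)
Lemma act_generator n x :
  act ((s ^+ n)^-1 * (t * s ^+ n)) (x, 0%R) = (g n x, 0%R).
Proof.
rewrite !actM act_shift -[act t _]/(g n x, Posz n) -(act_shift n (g n x)).
exact: actVK.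
Qed.

(** On level [n] read the [n]-th cylinder condition on the code of the point. *)
Definition bit (p : X * int) : Prop :=
  if p.2 is Posz n then
    (if (unpickle n : option (nat * nat)) is Some (i, m) then e p.1 i = m else False)
  else False.

(** The labelling of [Gamma] by the bits along the orbit of [(x, 0)], inverted so
    that moving [x] along its orbit translates the labelling from the left. *)
Definition marks (x : X) (c : Gamma) : Prop := bit (act c^-1 (x, 0%R)).

Lemma marks_translate x x' a : (x', 0%R) = act a (x, 0%R) ->
  forall c, marks x' c <-> marks x (a^-1 * c).
Proof. by move=> xx' c; rewrite /marks xx' -actM invgM invgK. Qed.

Lemma marks_inj x x' : (forall c, marks x c <-> marks x' c) -> x = x'.
Proof.
move=> xx'; apply: e_inj; apply/funext => i.
have := xx' (s ^+ (pickle (i, e x i)))^-1.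
by rewrite /marks invgK !act_shift /bit /= pickleK => -[/(_ erefl)].
Qed.

(** A fixed word changes the level in a way that does not depend on the point, and
    it moves the point by a composition of the Borel maps [g k]. *)
Lemma meas_marks c : measurable [set x | marks x c].
Proof.
have [h [m [mh hP]]] : exists h m, measurable_fun setT h /\
    forall x, act c^-1 (x, 0%R) = (h x, m).
  rewrite /act; elim: (word_of _) => [|l w [h [m [mh hP]]]].
    by exists id, 0%R; split=> //; exact: measurable_id.
  case El: l.1.
    by exists h, (m + (if l.2 then 1 else -1))%R; split=> // x; rewrite /= hP /step El.
  case: m hP => [n|n] hP.
    exists (g n \o h), (Posz n); split; first exact: measurableT_comp.
    by move=> x; rewrite /= hP /step El.
  by exists h, (Negz n); split=> // x; rewrite /= hP /step El.
rewrite (_ : [set x | _] = [set x | bit (h x, m)]); last first.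
  by apply/seteqP; split=> x; rewrite /= /marks hP.
rewrite /bit /=; case: m {hP} => [n|n]; last exact: meas_prop.
case: unpickle => [[i k]|]; last exact: meas_prop.
exact: (meas_coord i (fun z => z = k) (measurableT_comp me mh)).
Qed.

Lemma encoding_exists x : exists N : BO_space, mem_BO N = hall (marks x).
Proof.
apply: BO_build; first exact: hall_normal.
  by exists 4%N; exact: hall_gen.
exact: (bi_orderable_cone (hall_bi_orderable (hall_normal (marks x)))).
Qed.

Lemma encoding : exists f : X -> BO_space,
  [/\ measurable_fun setT f, injective f &
      forall k x, BO_iso (f (g k x)) (f x)].
Proof.
have [f fE] := choice encoding_exists; exists f; split.
- apply: meas_fun_BO => w; rewrite (_ : [set x | _] = [set x | hall (marks x) w]).
    apply: meas_all => c; apply: meas_imp; first exact: meas_marks.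
    exact: meas_prop.
  by apply/seteqP; split=> x /=; rewrite fE.
- move=> x x' xx'; apply: marks_inj => c.
  by rewrite !hall_mem -!fE xx'.
move=> k x; pose a := (s ^+ k)^-1 * (t * s ^+ k).
have kx := marks_translate (esym (act_generator k x)).
apply: (quotient_iso (phi := theta a)); first exact: thetaM.
  move=> w; rewrite -[ns_set _ _]/(mem_BO _ _).
  by rewrite -[ns_set _ (theta a w)]/(mem_BO _ _) !fE; exact: hall_translate.
move=> w; exists (theta a^-1 w); rewrite theta_comp mulVg theta1 mulVg.
by have [] := BO_normal (f x).
Qed.

End Universality.

Theorem mainTheorem1 (R : realType) :
  weakly_universal R (BO_iso : BO_space -> BO_space -> Prop).
Proof.
split; first exact: BO_iso_countable_borel.
move=> d Y F [sY [Fxx Fsym _] mF cF].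
have [e [r [me mr er]]] := standard_borel_retract sY.
have [g [mg gK gF]] := feldman_moore me mr er Fxx Fsym mF cF.
have [f [mf f_inj f_iso]] := encoding me (can_inj er) mg gK.
exists f; split=> // [N|x x' /Fsym /gF[k <-]]; last exact: f_iso.
have [[x fx]|nx] := pselect (exists x, f x = N); last first.
  rewrite (_ : preimage f _ = set0); first exact: countable0.
  by rewrite -subset0 => x fx; apply: nx; exists x.
apply: (@sub_countable _ _ _ (set1 x)) (countable1 x).
by apply: subset_card_le => x' /= fx'; apply: f_inj; rewrite fx fx'.
Qed.
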